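(* Given an EFD-sentence $\varphi$ (in the language $\{+,-,0,\vee,\wedge\}$) with a nontrivial model in $\mathcal{G}$, there is a positive integer $k$ such that $\varphi\sim\delta_k$ in $\mathcal{G}$.
   Context: $\mathcal G$ is the variety of Abelian $\ell$-groups in the language $\{+,-,0,\vee,\wedge\}$ ($(A,+,-,0)$ an Abelian group, $(A,\vee,\wedge)$ a lattice, $a+(b\vee c)=(a+b)\vee(a+c)$). An EFD-sentence is a sentence $\forall x_1\dots x_n\exists! z_1\dots z_m\bigwedge_{i=1}^k s_i(\bar x,\bar z)=t_i(\bar x,\bar z)$ with terms $s_i,t_i$, $n\ge0$, $m\ge1$. $\delta_k:=\forall x\exists! z\;kz=x$. For sentences $\varphi,\psi$ and a class $\mathcal K$, $\varphi\sim\psi$ in $\mathcal K$ means that for every $\mathbf A\in\mathcal K$, $\mathbf A\models\varphi$ iff $\mathbf A\models\psi$. *)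

(* Defs.v *)
From mathcomp Require Import all_boot all_algebra.

Set Implicit Arguments.
Unset Strict Implicit.
Unset Printing Implicit Defensive.

Import GRing.Theory.

Local Open Scope ring_scope.

(* This is a plain record over zmodType because Hierarchy Builder rejects a new
   join of GRing.Zmodule and Order.Lattice: numeric domains, already declared,
   inherit from both. *)
Record abelianLGroup : Type := AbelianLGroup {
  lg_sort :> zmodType;
  lg_join : lg_sort -> lg_sort -> lg_sort;
  lg_meet : lg_sort -> lg_sort -> lg_sort;
  lg_joinC : commutative lg_join;
  lg_joinA : associative lg_join;
  lg_meetC : commutative lg_meet;
  lg_meetA : associative lg_meet;
  lg_joinKI : forall a b, lg_join a (lg_meet a b) = a;
  lg_meetKU : forall a b, lg_meet a (lg_join a b) = a;
  lg_addr_joinr : forall a b c, a + lg_join b c = lg_join (a + b) (a + c)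
}.

Definition nontrivial (A : abelianLGroup) : Prop := exists a b : A, a <> b.

Inductive term (V : Type) : Type :=
  | Var of V
  | Zero
  | Opp of term V
  | Add of term V & term V
  | Join of term V & term V
  | Meet of term V & term V.

Arguments Zero {V}.

Fixpoint eval (V : Type) (A : abelianLGroup) (e : V -> A) (t : term V) : A :=
  match t with
  | Var v => e v
  | Zero => 0
  | Opp t1 => - eval e t1
  | Add t1 t2 => eval e t1 + eval e t2
  | Join t1 t2 => lg_join (eval e t1) (eval e t2)
  | Meet t1 t2 => lg_meet (eval e t1) (eval e t2)
  end.

(* The variable inl i stands for the universally quantified x_i and inr j for
   the uniquely existentially quantified z_j. *)
Record efd_sentence : Type := EFD {
  efd_n : nat;
  efd_m : nat;
  efd_m_gt0 : (0 < efd_m)%N;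
  efd_k : nat;
  efd_lhs : 'I_efd_k -> term ('I_efd_n + 'I_efd_m);
  efd_rhs : 'I_efd_k -> term ('I_efd_n + 'I_efd_m)
}.

Definition assign (n m : nat) (A : Type)
    (x : {ffun 'I_n -> A}) (z : {ffun 'I_m -> A}) (v : 'I_n + 'I_m) : A :=
  match v with inl i => x i | inr j => z j end.

Definition models (A : abelianLGroup) (phi : efd_sentence) : Prop :=
  forall x : {ffun 'I_(efd_n phi) -> A},
  exists! z : {ffun 'I_(efd_m phi) -> A},
  forall i : 'I_(efd_k phi),
    eval (assign x z) (efd_lhs i) = eval (assign x z) (efd_rhs i).

Definition sim (phi psi : efd_sentence) : Prop :=
  forall A : abelianLGroup, models A phi <-> models A psi.

(* The term t + ... + t with k summands (and 0 for k = 0). *)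
Definition nmul (V : Type) (k : nat) (t : term V) : term V :=
  iterop k (@Add V) t Zero.

Definition delta (k : nat) : efd_sentence :=
  @EFD 1 1 isT 1 (fun=> nmul k (Var (inr ord0))) (fun=> Var (inl ord0)).

(* Main.v *)
From HB Require Import structures.
Require Import Defs.
From mathcomp Require Import all_boot all_order all_algebra.
From mathcomp Require Import boolp.
From mathcomp Require Import ring lra zify.

Set Implicit Arguments.
Unset Strict Implicit.
Unset Printing Implicit Defensive.

Import Order.TTheory GRing.Theory Num.Theory.

(* A Horn clause valid in Z holds in every Abelian l-group (Farkas' lemma), and
   Z embeds in every nontrivial one.  Hence, if phi has a nontrivial model,
   uniqueness holds everywhere, and over Z every system phi(x, z) becomes
   solvable after multiplying x by some positive integer.  The solution function
   f on Q^n is linear on each of finitely many closed cones covering Q^n, so its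
   values on Z^n have a common denominator K.  If b is the denominator of some
   value of f on Z^n, every model of phi is b-divisible; let k be the product of
   all b <= K which divide every model.  Then g = k f is integer valued on Z^n,
   so that each linear piece of g extends to an integral linear form.  A
   crossing argument on segments turns these forms into a max-min expression for
   g, i.e. a term; the identity phi(k x, g(x)) transfers from Z to every
   l-group, and in a k-divisible one it is divided by k. *)

(** * Order, disjointness and convex subgroups in an Abelian l-group *)

Section LGroupTheory.
Local Open Scope ring_scope.
Variable A : abelianLGroup.
Implicit Types a b c d h s x y z w : A.

Definition lle x y := lg_join x y = y.
Local Notation "x <<= y" := (lle x y) (at level 70).

Lemma lle_refl x : x <<= x.
Proof. by rewrite /lle -{2}(lg_meetKU x x) lg_joinKI. Qed.

Lemma lle_trans y x z : x <<= y -> y <<= z -> x <<= z.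
Proof. by rewrite /lle => xy yz; rewrite -yz lg_joinA xy. Qed.

Lemma lle_anti x y : x <<= y -> y <<= x -> x = y.
Proof. by rewrite /lle lg_joinC => -> . Qed.

Lemma lle_joinl x y : x <<= lg_join x y.
Proof. by rewrite /lle lg_joinA (lle_refl x). Qed.

Lemma lle_joinr x y : y <<= lg_join x y.
Proof. by rewrite lg_joinC; exact: lle_joinl. Qed.

Lemma lle_join x y z : x <<= z -> y <<= z -> lg_join x y <<= z.
Proof. by rewrite /lle => xz yz; rewrite -lg_joinA yz. Qed.

Lemma lle_meetl x y : lg_meet x y <<= x.
Proof. by rewrite /lle lg_joinC lg_joinKI. Qed.

Lemma lle_meetr x y : lg_meet x y <<= y.
Proof. by rewrite lg_meetC; exact: lle_meetl. Qed.

Lemma lle_meet_id x y : x <<= y -> lg_meet x y = x.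
Proof. by rewrite /lle => <-; rewrite lg_meetKU. Qed.

Lemma lle_meet x y z : z <<= x -> z <<= y -> z <<= lg_meet x y.
Proof.
move=> /lle_meet_id zx /lle_meet_id zy.
by rewrite -zy -zx -lg_meetA; exact: lle_meetr.
Qed.

Lemma lleD2l a x y : x <<= y -> a + x <<= a + y.
Proof. by rewrite /lle => xy; rewrite -lg_addr_joinr xy. Qed.

Lemma lleD x y z w : x <<= y -> z <<= w -> x + z <<= y + w.
Proof.
move=> xy zw; apply: (@lle_trans (x + w)); first exact: lleD2l.
by rewrite ![_ + w]addrC; exact: lleD2l.
Qed.

Lemma lleN x y : x <<= y -> - y <<= - x.
Proof.
by move/(lleD2l (- x - y)); rewrite subrK addrAC addNr add0r.
Qed.

Lemma lle_subr_addl x y z : x <<= y + z -> x - y <<= z.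
Proof. by move/(lleD2l (- y)); rewrite addKr addrC. Qed.

Lemma addr_meetr a b c : a + lg_meet b c = lg_meet (a + b) (a + c).
Proof.
apply: lle_anti.
  by apply: lle_meet; apply: lleD2l; [exact: lle_meetl | exact: lle_meetr].
rewrite -[X in X <<= _](addKr (- a)) opprK; apply: lleD2l.
by apply: lle_meet; rewrite addrC; apply: lle_subr_addl;
  [exact: lle_meetl | exact: lle_meetr].
Qed.

Lemma lle0D x y : 0 <<= x -> 0 <<= y -> 0 <<= x + y.
Proof. by move=> x0 y0; rewrite -(addr0 0); exact: lleD. Qed.

Lemma lleDr x y : 0 <<= y -> x <<= x + y.
Proof. by move=> y0; rewrite -{1}(addr0 x); exact: lleD2l. Qed.

Lemma lle0Mn x n : 0 <<= x -> 0 <<= x *+ n.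
Proof.
move=> x0; elim: n => [|n ih]; first by rewrite mulr0n; exact: lle_refl.
by rewrite mulrS; exact: lle0D.
Qed.

Lemma lleMn2r n x y : x <<= y -> x *+ n <<= y *+ n.
Proof.
move=> xy; elim: n => [|n ih]; first by rewrite !mulr0n; exact: lle_refl.
by rewrite !mulrS; exact: lleD.
Qed.

Lemma lleMn2l x n m : 0 <<= x -> (n <= m)%N -> x *+ n <<= x *+ m.
Proof.
by move=> x0 /subnKC <-; rewrite mulrnDr; apply: lleDr; exact: lle0Mn.
Qed.

Definition labs x := lg_join x (- x).

Lemma labs_le0 x : labs x <<= 0 -> x = 0.
Proof.
move=> x0; apply: lle_anti; first exact: lle_trans (lle_joinl _ _) x0.
have := lle_trans (lle_joinr _ _) x0.
by move/lleN; rewrite opprK oppr0.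
Qed.

(** With [n] the negative part of [d] and [w] the meet, [n - w] still bounds both [- d] and [0] from
    above. Hence [n] lies below [n - w], that is, [w] lies below [0]. *)
Lemma meet_pos_neg d : lg_meet (lg_join d 0) (lg_join (- d) 0) = 0.
Proof.
apply: lle_anti; last by apply: lle_meet; exact: lle_joinr.
set w := lg_meet _ _; set n := lg_join (- d) 0.
have dE : lg_join d 0 = n + d by rewrite addrC lg_addr_joinr addrN addr0 lg_joinC.
have nw : n <<= n - w.
  apply: lle_join.
    rewrite -[- d]opprK opprK -[n - w]opprK opprB; apply: lleN.
    by apply: lle_subr_addl; rewrite -dE; exact: lle_meetl.
  rewrite -oppr0 -[n - w]opprK opprB; apply: lleN.
  by apply: lle_subr_addl; rewrite addr0; exact: lle_meetr.
by have := lleD2l (w - n) nw; rewrite addrA !subrK subrr.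
Qed.

(** Since [- y] lies below [y], the negative part of [y] lies below the positive part; as the two
    are disjoint, the negative part is [0]. *)
Lemma labs_ge0 x : 0 <<= labs x.
Proof.
set y := labs x; have y2 : - y <<= y.
  apply: (@lle_trans x); last exact: lle_joinl.
  by rewrite -[X in _ <<= X]opprK; apply: lleN; exact: lle_joinr.
have np : lg_join (- y) 0 <<= lg_join y 0.
  apply: lle_join; last exact: lle_joinr.
  by apply: lle_trans y2 _; exact: lle_joinl.
have /lleN := lle_joinl (- y) 0.
by rewrite -{1}(lle_meet_id np) lg_meetC meet_pos_neg oppr0 opprK.
Qed.

Lemma disjointMn x y n : 0 <<= x -> 0 <<= y ->
  lg_meet x y = 0 -> lg_meet x (y *+ n) = 0.
Proof.
move=> x0 y0 xy; elim: n => [|n ih].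
  by rewrite mulr0n lg_meetC; exact: lle_meet_id.
apply: lle_anti; last by apply: lle_meet => //; exact: lle0Mn.
have -> : 0 = lg_meet x y + lg_meet x (y *+ n) by rewrite xy ih addr0.
rewrite mulrS.
have yn0 := lle0Mn n y0.
rewrite addr_meetr; apply: lle_meet.
  apply: lle_trans (lle_meetl _ _) _; rewrite addrC; apply: lleDr.
  by rewrite xy; exact: lle_refl.
rewrite [X in _ <<= X]addrC addr_meetr; apply: lle_meet.
  by apply: lle_trans (lle_meetl _ _) _; rewrite addrC; exact: lleDr.
by rewrite [_ + y]addrC; exact: lle_meetr.
Qed.

Lemma disjointMnMn x y n : 0 <<= x -> 0 <<= y ->
  lg_meet x y = 0 -> lg_meet (x *+ n) (y *+ n) = 0.
Proof.
move=> x0 y0 xy; apply: disjointMn => //; first exact: lle0Mn.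
by rewrite lg_meetC; apply: disjointMn => //; rewrite lg_meetC.
Qed.

(* [lle_mod s] is the order of the quotient by the convex subgroup
   generated by [s]. *)
Definition lle_mod s x y := exists n, x <<= y + s *+ n.

Lemma lle_mod_refl s x : lle_mod s x x.
Proof. by exists 0; rewrite mulr0n addr0; exact: lle_refl. Qed.

Lemma lle_mod_trans s y x z : lle_mod s x y -> lle_mod s y z -> lle_mod s x z.
Proof.
move=> [n xy] [m yz]; exists (m + n); apply: lle_trans xy _.
by rewrite mulrnDr addrA; apply: lleD => //; exact: lle_refl.
Qed.

Lemma lle_modD s x y z w :
  lle_mod s x y -> lle_mod s z w -> lle_mod s (x + z) (y + w).
Proof.
move=> [n xy] [m zw]; exists (n + m).
by rewrite mulrnDr addrACA; exact: lleD.
Qed.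

Lemma lle_modN s x y : lle_mod s x y -> lle_mod s (- y) (- x).
Proof.
move=> [n xy]; exists n; have := lleD2l (- y - x) xy.
by rewrite subrK [- y - x]addrC addrA subrK.
Qed.

Lemma lle_mod_subr_ge0 s x y : lle_mod s 0 (x - y) -> lle_mod s y x.
Proof.
by move/(lle_modD (lle_mod_refl s y)); rewrite addr0 addrC subrK.
Qed.

Lemma lle_mod_join s x y z : 0 <<= s ->
  lle_mod s x z -> lle_mod s y z -> lle_mod s (lg_join x y) z.
Proof.
move=> s0 [n xz] [m yz]; exists (n + m); apply: lle_join.
  by apply: lle_trans xz _; apply: lleD2l; apply: lleMn2l => //; exact: leq_addr.
by apply: lle_trans yz _; apply: lleD2l; apply: lleMn2l => //; exact: leq_addl.
Qed.

Lemma lle_mod_meet s x y z : 0 <<= s ->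
  lle_mod s z x -> lle_mod s z y -> lle_mod s z (lg_meet x y).
Proof.
move=> s0 [n zx] [m zy]; exists (n + m).
rewrite addrC addr_meetr; apply: lle_meet; rewrite [X in _ <<= X]addrC.
  by apply: lle_trans zx _; apply: lleD2l; apply: lleMn2l => //; exact: leq_addr.
by apply: lle_trans zy _; apply: lleD2l; apply: lleMn2l => //; exact: leq_addl.
Qed.

Lemma lle_mod_mono s s' x y : s <<= s' -> lle_mod s x y -> lle_mod s' x y.
Proof.
move=> ss [n xy]; exists n; apply: lle_trans xy _.
by apply: lleD2l; exact: lleMn2r.
Qed.

(** A substitute for passing to a totally ordered quotient: adding to [s] the positive or the
    negative part of [d] decides the sign of [d]. At least one of the two choices keeps [h] from
    falling below [0]. *)
Lemma lle_mod_split s h d : 0 <<= s -> ~ lle_mod s h 0 ->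
  exists s', [/\ s <<= s', ~ lle_mod s' h 0 & lle_mod s' d 0 \/ lle_mod s' 0 d].
Proof.
move=> s0 hs; pose p := lg_join d 0; pose q := lg_join (- d) 0.
have p0 : 0 <<= p by exact: lle_joinr.
have q0 : 0 <<= q by exact: lle_joinr.
have [hp|hp] := pselect (lle_mod (s + p) h 0); last first.
  exists (s + p); split => //; [exact: lleDr|left; exists 1%N].
  rewrite add0r mulr1n; apply: lle_trans (lle_joinl d 0) _.
  by rewrite addrC; exact: lleDr.
have [hq|hq] := pselect (lle_mod (s + q) h 0); last first.
  exists (s + q); split => //; [exact: lleDr|right; exists 1%N].
  rewrite mulr1n -(addrN d); apply: lleD2l.
  by apply: lle_trans (lle_joinl (- d) 0) _; rewrite addrC; exact: lleDr.
case: hs; move: hp hq => [n hn] [m hm]; exists (n + m); rewrite add0r.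
(* If both choices fail, [h] lies below multiples of [s + p] and of [s + q]; multiples of [p] and
   [q] being disjoint, the meet of these bounds is a multiple of [s]. *)
have E := disjointMnMn (n + m) p0 q0 (meet_pos_neg d).
rewrite -[_ *+ _]addr0 -E addr_meetr -!mulrnDl; apply: lle_meet.
  apply: lle_trans hn _; rewrite add0r; apply: lleMn2l; last exact: leq_addr.
  exact: lle0D.
apply: lle_trans hm _; rewrite add0r; apply: lleMn2l; last exact: leq_addl.
exact: lle0D.
Qed.

End LGroupTheory.

(** * Terms as piecewise linear functions *)

Lemma eval_ext (V : Type) (A : abelianLGroup) (e e' : V -> A) (t : term V) :
  e =1 e' -> eval e t = eval e' t.
Proof.
by move=> ee; elim: t => //= [t -> | t -> u -> | t -> u -> | t -> u ->].
Qed.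

Section LinearPieces.
Local Open Scope ring_scope.
Variable V : finType.

Definition lform := {ffun V -> int}.

Definition lvar (v : V) : lform := [ffun w => (w == v)%:R].

(** A pair [(l, cs)] records that [t] coincides with the linear form [l] wherever all forms in [cs]
    are nonnegative. *)
Fixpoint pieces (t : term V) : seq (lform * seq lform) :=
  match t with
  | Var v => [:: (lvar v, [::])]
  | Zero => [:: (0, [::])]
  | Opp t => [seq (- p.1, p.2) | p <- pieces t]
  | Add t u => [seq (p.1 + q.1, p.2 ++ q.2) | p <- pieces t, q <- pieces u]
  | Join t u =>
      [seq (p.1, p.1 - q.1 :: p.2 ++ q.2) | p <- pieces t, q <- pieces u] ++
      [seq (q.1, q.1 - p.1 :: p.2 ++ q.2) | p <- pieces t, q <- pieces u]
  | Meet t u =>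
      [seq (q.1, p.1 - q.1 :: p.2 ++ q.2) | p <- pieces t, q <- pieces u] ++
      [seq (p.1, q.1 - p.1 :: p.2 ++ q.2) | p <- pieces t, q <- pieces u]
  end.

Section Eval.
Variables (A : abelianLGroup) (e : V -> A).
Local Notation "x <<= y" := (lle x y) (at level 70).

Definition leval (l : lform) : A := \sum_v e v *~ l v.

Lemma leval_is_additive : zmod_morphism leval.
Proof.
move=> l l'; rewrite /leval -sumrB; apply: eq_bigr => v _.
by rewrite !ffunE mulrzBr.
Qed.

HB.instance Definition _ :=
  GRing.isZmodMorphism.Build lform A leval leval_is_additive.

Lemma leval_var v : leval (lvar v) = e v.
Proof.
rewrite /leval (bigD1 v) //= big1 ?addr0 => [|w /negPf wv].
  by rewrite ffunE eqxx.
by rewrite ffunE wv.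
Qed.

Lemma eval_piece t p : p \in pieces t ->
  (forall c, c \in p.2 -> 0 <<= leval c) -> eval e t = leval p.1.
Proof.
elim: t p => /= [v|| t IHt | t IHt u IHu | t IHt u IHu | t IHt u IHu] p.
- by rewrite inE => /eqP -> /=; rewrite leval_var.
- by rewrite inE => /eqP -> /=; rewrite raddf0.
- by case/mapP => q qt -> /= /(IHt _ qt) ->; rewrite raddfN.
- case/allpairsP => -[q r] [/= qt ru ->] /= H.
  rewrite raddfD (IHt _ qt) ?(IHu _ ru) // => c cr; apply: H.
    by rewrite mem_cat cr orbT.
  by rewrite mem_cat cr.
- rewrite mem_cat => /orP[] /allpairsP [[q r] [/= qt ru ->]] /= H;
    rewrite (IHt _ qt) ?(IHu _ ru);
    try by move=> c cr; apply: H; rewrite inE mem_cat cr ?orbT.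
  + have /lleD2l := H _ (mem_head _ _).
    by move/(_ (leval r.1)); rewrite addr0 raddfB addrC subrK /lle lg_joinC.
  + have /lleD2l := H _ (mem_head _ _).
    by move/(_ (leval q.1)); rewrite addr0 raddfB addrC subrK.
- rewrite mem_cat => /orP[] /allpairsP [[q r] [/= qt ru ->]] /= H;
    rewrite (IHt _ qt) ?(IHu _ ru);
    try by move=> c cr; apply: H; rewrite inE mem_cat cr ?orbT.
  + have /lleD2l := H _ (mem_head _ _).
    move/(_ (leval r.1)); rewrite addr0 raddfB addrC subrK lg_meetC.
    exact: lle_meet_id.
  + have /lleD2l := H _ (mem_head _ _).
    move/(_ (leval q.1)); rewrite addr0 raddfB addrC subrK.
    exact: lle_meet_id.
Qed.

Definition active_mod s t (p : lform * seq lform) :=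
  [/\ p \in pieces t, lle_mod s (eval e t) (leval p.1),
      lle_mod s (leval p.1) (eval e t)
    & forall c, c \in p.2 -> lle_mod s 0 (leval c)].

Lemma active_mod_mono s s' t p : s <<= s' ->
  active_mod s t p -> active_mod s' t p.
Proof.
move=> ss [pt tp pt' H]; split=> //; try exact: (lle_mod_mono ss).
by move=> c /H; exact: (lle_mod_mono ss).
Qed.

(** In an arbitrary l-group the two arguments of a join or meet need not be comparable. At each such
    node [lle_mod_split] enlarges [s] until they are, without ever putting [h] below [0]. *)
Lemma select_piece t s h : 0 <<= s -> ~ lle_mod s h 0 ->
  exists s' p, [/\ s <<= s', ~ lle_mod s' h 0 & active_mod s' t p].
Proof.
have case2 t1 t2 :
    (forall s, 0 <<= s -> ~ lle_mod s h 0 ->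
       exists s' p, [/\ s <<= s', ~ lle_mod s' h 0 & active_mod s' t1 p]) ->
    (forall s, 0 <<= s -> ~ lle_mod s h 0 ->
       exists s' p, [/\ s <<= s', ~ lle_mod s' h 0 & active_mod s' t2 p]) ->
    forall s, 0 <<= s -> ~ lle_mod s h 0 -> exists s' p q,
      [/\ s <<= s', ~ lle_mod s' h 0, active_mod s' t1 p, active_mod s' t2 q &
          lle_mod s' 0 (leval (q.1 - p.1)) \/ lle_mod s' 0 (leval (p.1 - q.1))].
  move=> H1 H2 {}s s0 hs.
  have [s1 [p [ss1 hs1 a1]]] := H1 s s0 hs.
  have s10 := lle_trans s0 ss1.
  have [s2 [q [ss2 hs2 a2]]] := H2 s1 s10 hs1.
  have s20 := lle_trans s10 ss2.
  have [s3 [ss3 hs3 c]] := lle_mod_split (leval (p.1 - q.1)) s20 hs2.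
  exists s3, p, q; split=> //.
  - exact: lle_trans (lle_trans ss1 ss2) ss3.
  - exact: active_mod_mono (lle_trans ss2 ss3) a1.
  - exact: active_mod_mono ss3 a2.
  case: c => c; [left|by right].
  by have := lle_modN c; rewrite oppr0 -raddfN opprB.
have in2 (s' : A) (p q : lform * seq lform) (d : lform) :
    (forall c, c \in p.2 -> lle_mod s' 0 (leval c)) ->
    (forall c, c \in q.2 -> lle_mod s' 0 (leval c)) ->
    lle_mod s' 0 (leval d) ->
    forall c, c \in d :: p.2 ++ q.2 -> lle_mod s' 0 (leval c).
  move=> Hp Hq Hd c; rewrite inE mem_cat => /or3P[/eqP -> //|/Hp //|/Hq //].
elim: t s => /= [v|| t IHt | t IHt u IHu | t IHt u IHu | t IHt u IHu] s s0 hs.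
- exists s, (lvar v, [::]); split=> //; first exact: lle_refl.
  by split=> //=; rewrite ?inE ?leval_var //; exact: lle_mod_refl.
- exists s, (0, [::]); split=> //; first exact: lle_refl.
  by split=> //=; rewrite ?inE ?raddf0 //; exact: lle_mod_refl.
- have [s' [p [ss hs' [pt tp pt' H]]]] := IHt s s0 hs.
  exists s', (- p.1, p.2); split=> //; split=> //=.
  + by apply/mapP; exists p.
  + by rewrite raddfN; exact: lle_modN.
  + by rewrite raddfN; exact: lle_modN.
- have [s' [p [q [ss hs' [pt tp pt' Hp] [qu uq qu' Hq] _]]]] :=
    case2 _ _ IHt IHu s s0 hs.
  exists s', (p.1 + q.1, p.2 ++ q.2); split=> //; split=> /=.
  + by apply/allpairsP; exists (p, q).
  + by rewrite raddfD; exact: lle_modD.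
  + by rewrite raddfD; exact: lle_modD.
  + by move=> c; rewrite mem_cat => /orP[/Hp|/Hq].
- have [s' [p [q [ss hs' [pt tp pt' Hp] [qu uq qu' Hq] C]]]] :=
    case2 _ _ IHt IHu s s0 hs.
  have s'0 := lle_trans s0 ss.
  case: C => C.
  + exists s', (q.1, q.1 - p.1 :: p.2 ++ q.2); split=> //; split=> /=.
    * by rewrite mem_cat; apply/orP; right; apply/allpairsP; exists (p, q).
    * apply: lle_mod_join => //; apply: lle_mod_trans tp _.
      by apply: lle_mod_subr_ge0; rewrite -raddfB.
    * by apply: lle_mod_trans qu' _; exists 0; rewrite mulr0n addr0; exact: lle_joinr.
    * exact: in2.
  + exists s', (p.1, p.1 - q.1 :: p.2 ++ q.2); split=> //; split=> /=.
    * by rewrite mem_cat; apply/orP; left; apply/allpairsP; exists (p, q).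
    * apply: lle_mod_join => //; apply: lle_mod_trans uq _.
      by apply: lle_mod_subr_ge0; rewrite -raddfB.
    * by apply: lle_mod_trans pt' _; exists 0; rewrite mulr0n addr0; exact: lle_joinl.
    * exact: in2.
- have [s' [p [q [ss hs' [pt tp pt' Hp] [qu uq qu' Hq] C]]]] :=
    case2 _ _ IHt IHu s s0 hs.
  have s'0 := lle_trans s0 ss.
  case: C => C.
  + exists s', (p.1, q.1 - p.1 :: p.2 ++ q.2); split=> //; split=> /=.
    * by rewrite mem_cat; apply/orP; right; apply/allpairsP; exists (p, q).
    * by apply: lle_mod_trans _ tp; exists 0; rewrite mulr0n addr0; exact: lle_meetl.
    * apply: lle_mod_meet => //; apply: lle_mod_trans _ qu'.
      by apply: lle_mod_subr_ge0; rewrite -raddfB.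
    * exact: in2.
  + exists s', (q.1, p.1 - q.1 :: p.2 ++ q.2); split=> //; split=> /=.
    * by rewrite mem_cat; apply/orP; left; apply/allpairsP; exists (p, q).
    * by apply: lle_mod_trans _ uq; exists 0; rewrite mulr0n addr0; exact: lle_meetr.
    * apply: lle_mod_meet => //; apply: lle_mod_trans _ pt'.
      by apply: lle_mod_subr_ge0; rewrite -raddfB.
    * exact: in2.
Qed.

End Eval.

End LinearPieces.

(** * The l-group of integers, Farkas' lemma and the transfer of Horn clauses *)

Section Integers.
Local Open Scope ring_scope.

Fact int_joinKI (a b : int) : Order.max a (Order.min a b) = a.
Proof. by case: (leP a b) => [_|/ltW ba]; rewrite ?maxxx //; apply/max_idPl. Qed.

Fact int_meetKU (a b : int) : Order.min a (Order.max a b) = a.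
Proof. by case: (leP a b) => [ab|_]; rewrite ?minxx //; apply/min_idPl. Qed.

Fact int_addr_joinr (a b c : int) : a + Order.max b c = Order.max (a + b) (a + c).
Proof. exact: addr_maxr. Qed.

Definition int_lgroup : abelianLGroup :=
  @AbelianLGroup int Order.max Order.min (@maxC _ int) (@maxA _ int)
    (@minC _ int) (@minA _ int) int_joinKI int_meetKU int_addr_joinr.

Lemma lle_int (x y : int) : lle (x : int_lgroup) y <-> x <= y.
Proof. by rewrite /lle /=; split => [/max_idPr|/max_idPr]. Qed.

Variable V : finType.
Implicit Types (c g l : lform V) (cs : seq (lform V)) (e : V -> int).

Definition dot e c : int := \sum_v e v * c v.

Lemma leval_int e c : leval (e : V -> int_lgroup) c = dot e c.
Proof. by apply: eq_bigr => v _; exact: mulrzz. Qed.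

Lemma dot_is_additive e : zmod_morphism (dot e).
Proof.
by move=> c c'; rewrite /dot -sumrB; apply: eq_bigr => v _; rewrite !ffunE mulrBr.
Qed.

HB.instance Definition _ e :=
  GRing.isZmodMorphism.Build (lform V) int (dot e) (dot_is_additive e).

Lemma dot_lincomb e e' a b c :
  dot (fun v => e v * a + e' v * b) c = dot e c * a + dot e' c * b.
Proof.
rewrite /dot !mulr_suml -big_split; apply: eq_bigr => v _ /=.
by rewrite mulrDl !(mulrAC _ _ (c v)).
Qed.

(** Membership in the monoid generated by [cs]: combinations with natural coefficients. *)
Fixpoint in_cone cs g : Prop :=
  if cs is c :: cs then exists k : nat, in_cone cs (g - c *+ k) else g = 0.

(* Bartl's induction on the number of constraints, with denominators cleared:
   a counterexample for the tail lets one project the system onto the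
   hyperplane of the head. *)
Lemma farkas cs g :
  (forall e, (forall c, c \in cs -> 0 <= dot e c) -> 0 <= dot e g) ->
  exists2 n, (0 < n)%N & in_cone cs (g *+ n).
Proof.
have [n] := ubnP (size cs); elim: n cs g => // n IH [|c0 cs] g /= sz H.
  exists 1%N => //=; rewrite mulr1n; apply/ffunP => v; rewrite !ffunE.
  (* Testing at the point [- g] bounds the sum of the squares of the coefficients by [0]. *)
  have : 0 <= dot (fun v => - g v) g by exact: H.
  rewrite /dot; under eq_bigr do rewrite mulNr.
  rewrite sumrN oppr_ge0 => S.
  have : \sum_v g v * g v == 0.
    by rewrite eq_le S sumr_ge0 // => w _; rewrite -expr2 sqr_ge0.
  rewrite psumr_eq0 => [/allP /(_ v (mem_index_enum v))|w _].
    by rewrite /= mulf_eq0 orbb => /eqP.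
  by rewrite -expr2 sqr_ge0.
have [[e0 [He0 ge0]]|noe] := pselect
    (exists e, (forall c, c \in cs -> 0 <= dot e c) /\ dot e g < 0); last first.
  have [|m m0 cm] := IH cs g sz; last by exists m => //=; exists 0%N; rewrite subr0.
  by move=> e He; rewrite leNgt; apply/negP => eg; apply: noe; exists e.
have c00 : dot e0 c0 < 0.
  rewrite ltNge; apply/negP => c00; move: ge0; rewrite ltNge H // => c.
  by rewrite inE => /orP[/eqP -> //|/He0].
have [a aE] : exists a : nat, - dot e0 c0 = a by exists (absz (dot e0 c0)); lia.
have [b bE] : exists b : nat, - dot e0 g = b by exists (absz (dot e0 g)); lia.
(* Up to the factor [a], this projects forms along [c0] onto those vanishing at [e0]. *)
pose pr c := c *+ a + c0 *~ dot e0 c.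
have [||m m0] := IH (map pr cs) (pr g).
- by rewrite size_map.
(* Dually, [pr c] evaluates [c] at a multiple of the projection of [e] along [e0] onto the
   hyperplane where [c0] vanishes. *)
- have prE e c : dot e (pr c) = dot (fun v => e v * a + e0 v * dot e c0) c.
    by rewrite dot_lincomb raddfD raddfMz pmulrn raddfMz !mulrzz [dot e c0 * _]mulrC.
  move=> e He; rewrite prE; apply: H => c.
  rewrite inE => /orP[/eqP ->|ccs]; last by rewrite -prE; exact/He/map_f.
  by rewrite dot_lincomb -aE; lia.
(* The multiples of [c0] hidden in the projections have natural coefficients because [e0] is
   nonnegative on the tail. *)
have unproj l : in_cone (map pr cs) l -> exists k : nat, in_cone cs (l - c0 *+ k).
  elim: cs He0 {IH sz H} l => [_ l /= ->|c cs IHc He0 l /= [k /IHc []]].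
  - by exists 0%N; rewrite subr0.
  - by move=> c' cc'; apply: He0; rewrite inE cc' orbT.
  move=> k' kk'.
  have [d dE] : exists d : nat, dot e0 c = d.
    by exists (absz (dot e0 c)); rewrite gez0_abs // He0 ?mem_head.
  exists (k' + d * k)%N, (a * k)%N; move: kk'; congr in_cone.
  rewrite /pr dE -pmulrn mulrnDr mulrnDl !mulrnA !opprD !addrA.
  by rewrite [LHS](ACl (1*4*3*2)).
move=> /unproj [k kk]; exists (a * m)%N; first by rewrite muln_gt0 m0 andbT; lia.
exists (k + b * m)%N; move: kk; congr in_cone.
rewrite /pr -[dot e0 g]opprK bE mulrNz -pmulrn mulrnDr mulrnDl mulNrn !mulrnA.
by rewrite opprD addrA addrAC.
Qed.

Lemma in_cone_ge0 (A : abelianLGroup) (e : V -> A) s cs g : lle 0 s ->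
  in_cone cs g -> (forall c, c \in cs -> lle_mod s 0 (leval e c)) ->
  lle_mod s 0 (leval e g).
Proof.
move=> s0; elim: cs g => [_ -> _|c cs IH g /= [k /IH gk] H].
  by rewrite raddf0; exact: lle_mod_refl.
have c0 : lle_mod s 0 (leval e (c *+ k)).
  elim: k {gk} => [|k IHk]; first by rewrite mulr0n raddf0; exact: lle_mod_refl.
  rewrite mulrS raddfD -(addr0 0); apply: lle_modD => //.
  by apply: H; rewrite mem_head.
rewrite -(subrK (c *+ k) g) raddfD -(addr0 0); apply: lle_modD => //.
by apply: gk => c' cc'; apply: H; rewrite inE cc' orbT.
Qed.

Definition tabs (W : Type) (t : term W) : term W := Join t (Opp t).

(* A failure of the Horn clause in [A] survives modulo [lle_mod s] with both
   terms linear; were it impossible over the integers, Farkas' lemma would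
   refute it in [A] as well. *)
Theorem horn_transfer (u t : term V) :
  (forall e : V -> int_lgroup, eval e u = 0 -> eval e t = 0) ->
  forall (A : abelianLGroup) (e : V -> A), eval e u = 0 -> eval e t = 0.
Proof.
move=> HZ A e u0; apply: contrapT => t0.
pose h := labs (eval e t).
have h0 : ~ lle_mod 0 h 0.
  by case=> n; rewrite mul0rn addr0 => /labs_le0.
have [s1 [p [s10 hs1 [pu up pu0 Hp]]]] := select_piece e u (lle_refl 0) h0.
have [s [q [s1s hs [qt tq _ Hq]]]] := select_piece e (tabs t) s10 hs1.
have s0 := lle_trans s10 s1s.
(* The first two forms express that [u] vanishes; the others confine the point to the regions of the
   pieces [p] of [u] and [q] of [tabs t]. *)
pose cs := - p.1 :: p.1 :: p.2 ++ q.2.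
have Hcs c : c \in cs -> lle_mod s 0 (leval e c).
  rewrite u0 in up pu0; rewrite !inE mem_cat => /or4P[/eqP -> | /eqP -> | cp | cq].
  - rewrite raddfN -oppr0; apply: lle_modN; exact: lle_mod_mono pu0.
  - exact: lle_mod_mono up.
  - exact: lle_mod_mono (Hp _ cp).
  - exact: Hq.
have [n n0 cone] : exists2 n, (0 < n)%N & in_cone cs ((- q.1) *+ n).
  apply: farkas => e' He'; pose f : V -> int_lgroup := e'.
  have pos c : c \in cs -> lle 0 (leval f c).
    by move=> /He' ?; rewrite leval_int; apply/lle_int.
  have fu : eval f u = 0.
    have p0 := pos p.1; have pN := pos (- p.1).
    rewrite (eval_piece pu) => [|c cp]; last first.
      by apply: pos; rewrite !inE mem_cat cp !orbT.
    apply: lle_anti; last by apply: p0; rewrite !inE eqxx orbT.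
    by have := lleN (pN (mem_head _ _)); rewrite raddfN opprK oppr0.
  have ft : eval f (tabs t) = 0 by rewrite /= (HZ f fu) oppr0; exact: maxxx.
  have <- : leval f (- q.1) = dot e' (- q.1) by exact: leval_int.
  have fq : leval f q.1 = 0.
    rewrite -ft; symmetry; apply: (eval_piece qt) => c cq.
    by apply: pos; rewrite !inE mem_cat cq !orbT.
  by rewrite raddfN /= fq oppr0.
(* Modulo [s], the cone bounds [q.1 *+ n] by [0], whereas [h], the value of [tabs t], lies below
   [q.1]. Since [h] is nonnegative and [n] positive, [h] lies below [h *+ n], hence below [0]. *)
apply: hs; have := in_cone_ge0 s0 cone Hcs; rewrite raddfMn raddfN => qn.
have hn : lle_mod s (h *+ n) (leval e q.1 *+ n).
  elim: {qn cone} n {n0} => [|n IH]; first by rewrite !mulr0n; exact: lle_mod_refl.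
  by rewrite !mulrS; exact: lle_modD.
apply: (@lle_mod_trans _ _ (h *+ n)).
  exists 0%N; rewrite mulr0n addr0 -{1}(mulr1n h).
  exact/lleMn2l/n0/labs_ge0.
apply: lle_mod_trans hn _.
by have := lle_modN qn; rewrite mulNrn opprK oppr0.
Qed.

End Integers.

(** * Extending additive partial maps between lattices of integer vectors to matrices *)

Section LinearExtension.
Local Open Scope ring_scope.
(* With [T] all positive integers, [k] is a mere common denominator; with
   [T = {1}] the hypothesis is saturation, and the matrix is integral. *)
Variable T : nat -> Prop.
Hypotheses (T1 : T 1) (TM : forall a b, T a -> T b -> T (a * b)%N).

(* A nonzero row of a Smith normal form splits off one coordinate. *)
Lemma primitive_row n (v : 'rV[int]_(1 + n)) : v != 0 ->
  exists (R : 'M[int]_(1 + n)) c, [/\ R \in unitmx, c != 0 & v = c *: row 0 R].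
Proof.
move=> v0; have [L Lu [R Ru [d _ vE]]] := int_Smith_normal_form v.
have vR : v = (L 0 0 * d`_0) *: row 0 R.
  rewrite vE; apply/rowP => j; rewrite !mxE.
  rewrite (bigD1 0) //= big1 ?addr0 => [|k k0]; last first.
    rewrite mxE big1 ?mul0r // => l _; rewrite mxE [l]ord1.
    have -> : (0 == k :> nat) = false by rewrite eq_sym; exact: negbTE k0.
    by rewrite mulr0n mulr0.
  by rewrite mxE big_ord1 !mxE eqxx mulr1n.
exists R, (L 0 0 * d`_0); split => //.
by apply: contraNneq v0 => c0; rewrite vR c0 scale0r.
Qed.

(** Induction on the dimension. A nonzero vector of the domain is a multiple of the first row of a
    unimodular [R], and by saturation some multiple of that row by an element of [T] is in the
    domain. The other rows of [R] span a lattice of smaller rank, to which the induction hypothesis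
    applies. *)
Lemma linear_extension_group n m (G : 'rV[int]_n -> 'rV[int]_m -> Prop) :
  (forall v z v' z', G v z -> G v' z' -> G (v - v') (z - z')) ->
  (forall z, G 0 z -> z = 0) ->
  (forall (N : int) v z, N != 0 -> G (N *: v) z ->
     exists2 k : nat, T k & exists z', G (k%:Z *: v) z') ->
  exists2 k : nat, T k & exists M, forall v z, G v z -> k%:Z *: z = v *m M.
Proof.
elim: n G => [|n IH] G GB G0 Gsat.
  exists 1%N => //; exists 0 => v z; rewrite [v]thinmx0 => /G0 ->.
  by rewrite mul0mx scaler0.
have [[v0 [z0 [Gv0 v00]]]|none] :=
    pselect (exists v z, G v z /\ v != 0); last first.
  exists 1%N => //; exists 0 => v z Gvz; have [v0|v0] := eqVneq v 0.
    by move: Gvz; rewrite v0 => /G0 ->; rewrite mul0mx scaler0.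
  by case: none; exists v, z.
have GZ v z (a : int) : G v z -> G (a *: v) (a *: z).
  move=> Gvz; have G00 : G 0 0 by have := GB _ _ _ _ Gvz Gvz; rewrite !subrr.
  have GN v' z' : G v' z' -> G (- v') (- z').
    by move=> /(GB _ _ _ _ G00); rewrite !sub0r.
  have Gn (k : nat) : G (k%:Z *: v) (k%:Z *: z).
    elim: k => [|k]; first by rewrite !scale0r.
    move/GB => /(_ _ _ (GN _ _ Gvz)); rewrite !opprK intS !scalerDl !scale1r.
    by rewrite ![_ + v]addrC ![_ + z]addrC.
  case: (intP a) => [|k|k]; first exact: (Gn 0%N).
    exact: Gn.
  by rewrite !scaleNr; exact/GN/Gn.
have [R [c0 [Ru c00 v0E]]] := primitive_row v00.
rewrite v0E in Gv0; have [c Tc [zr Gr]] := Gsat _ _ _ c00 Gv0.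
pose G' w y := G (row_mx 0 w *m R) y.
have [v z v' z' H H'||N v z N0|k Tk [M kM]] := IH G'.
- rewrite /G'; have -> : row_mx 0 (v - v') = row_mx 0 v - row_mx 0 v' :> 'rV_(1 + n).
    by rewrite opp_row_mx add_row_mx subrr.
  by rewrite mulmxBl; exact: GB.
- by move=> z; rewrite /G' row_mx0 mul0mx; exact: G0.
- rewrite /G' -{1}[0](scaler0 _ N) -scale_row_mx -scalemxAl => /(Gsat _ _ _ N0).
  case=> k Tk [z' Gz']; exists k => //; exists z'.
  by rewrite scalemxAl scale_row_mx scaler0 in Gz'.
exists (k * c)%N; first exact: TM.
(* In the basis formed by the rows of [R], with [v] of coordinates [(a, w)], the aim is
   [k * c * z = a * k * zr + c * w * M]. It comes from applying [M] to [c * v] stripped of its first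
   coordinate. *)
exists (invmx R *m col_mx (k%:Z *: zr) (c%:Z *: M)) => v z Gvz.
set u := v *m invmx R; have vE : v = u *m R by rewrite mulmxKV.
rewrite mulmxA -/u -[u]hsubmxK mul_row_col [lsubmx u]mx11_scalar mul_scalar_mx.
set a := lsubmx u 0 0; set w := rsubmx u.
have : G' (c%:Z *: w) (c%:Z *: z - a *: zr).
  rewrite /G'; have -> : row_mx 0 (c%:Z *: w) *m R = c%:Z *: v - a *: (c%:Z *: row 0 R).
    have -> : row 0 R = usubmx R.
      by apply/rowP => j; rewrite !mxE; congr (R _ _); exact: val_inj.
    rewrite vE -[u]hsubmxK -/w [lsubmx u]mx11_scalar -/a -{1 2}[R]vsubmxK.
    rewrite !mul_row_col mul0mx add0r mul_scalar_mx scalerDr !scalerA mulrC.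
    by rewrite addrAC subrr add0r scalemxAl.
  by apply: GB; exact: GZ.
move/kM; rewrite scalerBr -scalemxAl scalemxAr => /eqP; rewrite subr_eq => /eqP E.
by rewrite PoszM -scalerA E addrC !scalerA mulrC.
Qed.

(** The integer points of a cone form only a monoid; [linear_extension_group] is applied to the
    group [G] of differences. *)
Lemma linear_extension n m (S : 'rV[int]_n -> 'rV[int]_m -> Prop) :
  S 0 0 ->
  (forall v z v' z', S v z -> S v' z' -> S (v + v') (z + z')) ->
  (forall v z z', S v z -> S v z' -> z = z') ->
  (forall N v z, (0 < N)%N -> S (v *+ N) z ->
     exists2 k, T k & exists z', S (v *+ k) z') ->
  exists2 k, T k & exists M, forall v z, S v z -> z *+ k = v *m M.
Proof.
move=> S00 SD Sfun Ssat.
have SM k v z : S v z -> S (v *+ k) (z *+ k).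
  by move=> Svz; elim: k => [|k IH]; rewrite ?mulr0n ?mulrS //; exact: SD.
pose G v z := exists v1 z1 v2 z2, [/\ S v1 z1, S v2 z2, v = v1 - v2 & z = z1 - z2].
have GS v z : S v z -> G v z by exists v, z, 0, 0; split=> //; rewrite subr0.
have [v z v' z'|z|N v z N0|k Tk [M kM]] := @linear_extension_group n m G.
- move=> [v1 [z1 [v2 [z2 [S1 S2 -> ->]]]]] [v3 [z3 [v4 [z4 [S3 S4 -> ->]]]]].
  exists (v1 + v4), (z1 + z4), (v2 + v3), (z2 + z3); split; try exact: SD.
    by rewrite !opprD !opprK !addrA [LHS](ACl (1*4*2*3)).
  by rewrite !opprD !opprK !addrA [LHS](ACl (1*4*2*3)).
- move=> [v1 [z1 [v2 [z2 [S1 S2 /eqP]]]]]; rewrite eq_sym subr_eq0 => /eqP v12 ->.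
  by rewrite v12 in S1; rewrite (Sfun _ _ _ S1 S2) subrr.
(* If [v *+ k = v1 - v2], then [(v + v2) *+ k = v1 + v2 *+ k.-1] is in the domain of [S]. Saturation
   of [S] applies to [v + v2], and the multiple of [v2] is subtracted afterwards. *)
- have satn (k : nat) y : (0 < k)%N -> G (v *+ k) y ->
      exists2 k : nat, T k & exists z', G (k%:Z *: v) z'.
    move=> k0 [v1 [z1 [v2 [z2 [S1 S2 vE _]]]]].
    have [|l Tl [z' Sz']] := Ssat k (v + v2) (z1 + z2 *+ k.-1) k0.
      have -> : (v + v2) *+ k = v1 + v2 *+ k.-1.
        by rewrite mulrnDl vE -{1}(prednK k0) mulrS addrA subrK.
      exact/SD/SM.
    exists l => //; exists (z' - z2 *+ l).
    exists ((v + v2) *+ l), z', (v2 *+ l), (z2 *+ l).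
    by split; [exact: Sz' | exact: SM | rewrite mulrnDl addrK -scaler_nat natz | ].
  case: (intP N) N0 => [//|k|k] _.
    by rewrite -natz scaler_nat => /satn; exact.
  rewrite scaleNr -natz scaler_nat => -[v1 [z1 [v2 [z2 [S1 S2 /eqP]]]]].
  rewrite eqr_oppLR opprB => /eqP vE _; apply: (satn k.+1 (z2 - z1)) => //.
  by exists v2, z2, v1, z1.
- exists k => //; exists M => v z /GS /kM <-.
  by rewrite -scaler_nat natz.
Qed.
End LinearExtension.

(** * Piecewise affine functions on a segment *)

Section Segment.
Local Open Scope ring_scope.
Variable F : realFieldType.
Implicit Types (c : F * F) (cs : seq (F * F)) (a b s : F).
Implicit Types (p : seq (F * F) * (F * F)).

Definition aff c s := c.1 + c.2 * s.

Definition active p s := all (fun c => 0 <= aff c s) p.1.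

Lemma aff_root c s t : s < t -> aff c s < 0 -> 0 <= aff c t ->
  exists r, [/\ s < r <= t, aff c r = 0 & forall s', s' < r -> aff c s' < 0].
Proof.
rewrite /aff => st cs ct.
have c2 : 0 < c.2.
  have : 0 < c.2 * (t - s) by lra.
  by rewrite pmulr_lgt0 // subr_gt0.
have rE : c.2 * (- c.1 / c.2) = - c.1 by rewrite mulrC divfK // gt_eqF.
exists (- c.1 / c.2); rewrite rE; split; [|lra|].
  by rewrite -(ltr_pM2l c2) -(ler_pM2l c2) rE; apply/andP; split; lra.
by move=> s'; rewrite -(ltr_pM2l c2) rE; lra.
Qed.

Lemma aff_ge0 c s r t :
  s <= r <= t -> 0 <= aff c s -> 0 <= aff c t -> 0 <= aff c r.
Proof.
rewrite /aff => /andP[sr rt] cs ct; have [c2|/ltW c2] := leP 0 c.2.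
  by have := ler_wpM2l c2 sr; lra.
by have := ler_wnM2l c2 rt; lra.
Qed.

Lemma aff_lt0 c s r t :
  s <= r <= t -> aff c s < 0 -> aff c t < 0 -> aff c r < 0.
Proof.
rewrite /aff => /andP[sr rt] cs ct; have [c2|/ltW c2] := leP 0 c.2.
  by have := ler_wpM2l c2 rt; lra.
by have := ler_wnM2l c2 sr; lra.
Qed.

(** Induction on the constraints: a new one that fails at the current first point moves it right to
    the root of that constraint. The earlier ones still hold there, by convexity. *)
Lemma first_point cs a b : a <= b -> all (fun c => 0 <= aff c b) cs ->
  exists s, [/\ a <= s <= b, all (fun c => 0 <= aff c s) cs &
    forall s', a <= s' < s -> ~~ all (fun c => 0 <= aff c s') cs].
Proof.
move=> ab; elim: cs => [_|c cs IH /= /andP[cb csb]].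
  exists a; split; rewrite ?lexx // => s' /andP[as' /(le_lt_trans as')].
  by rewrite ltxx.
have [s [/andP[as_ sb] css ns]] := IH csb.
have [c0|c0] := leP 0 (aff c s).
  exists s; rewrite as_ sb css c0; split=> // s' /ns /negPf ->; rewrite andbF //.
have sb' : s < b.
  by rewrite lt_neqAle sb andbT; apply: contraTneq cb => <-; rewrite -ltNge.
have [r [/andP[sr rb] r0 nr]] := aff_root sb' c0 cb.
exists r; rewrite r0 lexx (le_trans as_ (ltW sr)) rb; split=> //=; last first.
  by move=> s' /andP[_ /nr s'0]; rewrite leNgt s'0.
apply/allP => d dcs; have := allP css _ dcs; have := allP csb _ dcs.
by move=> db ds; apply: aff_ge0 ds db; rewrite (ltW sr).
Qed.

(** Each inactive piece has a constraint that is strictly violated, and this persists on a short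
    interval to the left; finitely many such intervals have a common part. *)
Lemma inactive_left (ps : seq (seq (F * F) * (F * F))) a s : a < s ->
  ~~ has (active^~ s) ps -> exists2 s0, a <= s0 < s &
    forall s', s0 <= s' < s -> ~~ has (active^~ s') ps.
Proof.
move=> as_; elim: ps => [_|p ps IH /=].
  by exists a => //; rewrite lexx.
rewrite negb_or => /andP[ps' /IH[s0 /andP[as0 s0s] H]].
have [c cp cs0] := allPn ps'; rewrite -ltNge in cs0.
have [s1 /andP[s01 s1s] H1] : exists2 s1, s0 <= s1 < s &
    forall s', s1 <= s' <= s -> aff c s' < 0.
  have [c0|c0] := ltP (aff c s0) 0.
    by exists s0; rewrite ?lexx // => s' /aff_lt0; exact.
  have c2 : c.2 < 0.
    rewrite ltNge; apply/negP => /ler_wpM2l/(_ _ _ (ltW s0s)).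
    by rewrite /aff in c0 cs0; lra.
  have rE : c.2 * (- c.1 / c.2) = - c.1 by rewrite mulrC divfK // lt_eqF.
  move: rE; set r := _ / _ => rE.
  have s0r : s0 <= r by rewrite -(ler_nM2l c2) rE; rewrite /aff in c0; lra.
  have rs : r < s by rewrite -(ltr_nM2l c2) rE; rewrite /aff in cs0; lra.
  (* The constraint is only zero at its root [r], so the interval has to start strictly to the right
     of [r]. *)
  exists ((r + s) / 2); first by apply/andP; split; lra.
  move=> s' /andP[rs' _]; have : r < s' by lra.
  by rewrite -(ltr_nM2l c2) rE /aff; lra.
exists s1; first by rewrite (le_trans as0).
move=> s' /andP[s1s' s's]; rewrite negb_or H ?(le_trans s01) // andbT.
apply/allPn; exists c => //; rewrite -ltNge H1 //; apply/andP; split; lra.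
Qed.

(** Induction on the number of pieces. If the piece [p] active at [b] is negative at [a], let [s] be
    the first point where [p] is active; [p] is at most [0] there. The other pieces cover the
    segment from [a] to [s], so one of them is nonnegative at [a] and at most [0] at [s]. Being
    affine, it does not increase, and stays at most [0] up to [b]. *)
Lemma crossing_piece (ps : seq (seq (F * F) * (F * F))) a b : a <= b ->
  (forall s, a <= s <= b -> has (active^~ s) ps) ->
  (forall p q s, p \in ps -> q \in ps -> active p s -> active q s ->
     aff p.2 s = aff q.2 s) ->
  (forall p, p \in ps -> active p a -> 0 <= aff p.2 a) ->
  (forall p, p \in ps -> active p b -> aff p.2 b <= 0) ->
  exists2 p, p \in ps & 0 <= aff p.2 a /\ aff p.2 b <= 0.
Proof.
have [n] := ubnP (size ps); elim: n ps b => // n IH ps b sz ab cover agree Ha Hb.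
have /hasP [p pps pb] := cover b (introT andP (conj ab (lexx b))).
have pb0 := Hb p pps pb.
have [pa|pa] := leP 0 (aff p.2 a); first by exists p.
have [s [/andP[as_ sb] psa ns]] := first_point ab pb.
have npa : ~~ active p a by apply/negP => /(Ha _ pps); rewrite leNgt pa.
have lt_as : a < s.
  by rewrite lt_neqAle as_ andbT; apply: contraNneq npa => ->.
have ps0 : aff p.2 s <= 0 by rewrite /aff in pa pb0 *; nra.
pose qs := [seq q <- ps | q != p].
have qsP q : q \in qs -> q \in ps by rewrite mem_filter => /andP[].
have coverl s' : a <= s' < s -> has (active^~ s') qs.
  move=> s'E; have /andP[as' s's] := s'E.
  have /hasP[q qps qs'] : has (active^~ s') ps.
    by apply: cover; rewrite as' (le_trans (ltW s's)).
  apply/hasP; exists q => //; rewrite mem_filter qps andbT.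
  by apply: contraTneq qs' => ->; exact: ns.
have [q /qsP qps [qa qs0]] : exists2 q, q \in qs & 0 <= aff q.2 a /\ aff q.2 s <= 0.
  apply: IH => //.
  - have : (0 < count (pred1 p) ps)%N by rewrite -has_count has_pred1.
    have := count_predC (pred1 p) ps.
    rewrite size_filter -[count (fun _ => _ != _) _]/(count (predC (pred1 p)) ps).
    move=> szE c0; rewrite -ltnS; apply: leq_trans sz; rewrite ltnS.
    by rewrite -[X in (_ < X)%N]szE -add1n leq_add2r.
  (* At [s] itself [p] may be the only piece known to be active; were all others inactive there,
     they would be inactive slightly to the left too, against [coverl]. *)
  - move=> s' /andP[as']; rewrite le_eqVlt => /orP[/eqP ->|s's]; last first.
      by apply: coverl; rewrite as'.
    apply: contraT => /(inactive_left lt_as) [s0 /andP[as0 s0s] /(_ s0)].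
    by rewrite lexx s0s => /(_ isT); rewrite coverl // as0.
  - by move=> q q' s' /qsP qps /qsP q'ps; exact: agree.
  - by move=> q /qsP; exact: Ha.
  - by move=> q /qsP qps q_s; rewrite (agree q p s).
exists q => //; split=> //; rewrite /aff in qa qs0 *.
have c2 : q.2.2 <= 0.
  by rewrite leNgt; apply/negP => c2; move: lt_as; rewrite -(ltr_pM2l c2); lra.
by have := ler_wnM2l c2 sb; lra.
Qed.

End Segment.

(** * Substitution, multiples, and laws transferred from the integers *)

Section Terms.
Local Open Scope ring_scope.

Fixpoint subst_term (V W : Type) (f : V -> term W) (t : term V) : term W :=
  match t with
  | Var v => f v
  | Zero => Zero
  | Opp t => Opp (subst_term f t)
  | Add t u => Add (subst_term f t) (subst_term f u)
  | Join t u => Join (subst_term f t) (subst_term f u)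
  | Meet t u => Meet (subst_term f t) (subst_term f u)
  end.

Definition tmulz (V : Type) (k : int) (t : term V) : term V :=
  match k with Posz n => nmul n t | Negz n => Opp (nmul n.+1 t) end.

Definition lterm (V : finType) (l : lform V) : term V :=
  foldr (fun v => Add (tmulz (l v) (Var v))) Zero (index_enum V).

Section Eval.
Variables (A : abelianLGroup) (V : Type).
Implicit Types (e : V -> A) (t : term V).

Lemma eval_subst_term (W : Type) (f : W -> term V) e (t : term W) :
  eval e (subst_term f t) = eval (fun v => eval e (f v)) t.
Proof. by elim: t => //= [t -> | t -> u -> | t -> u -> | t -> u ->]. Qed.

Lemma eval_nmul e t k : eval e (nmul k t) = eval e t *+ k.
Proof.
by case: k => // k; elim: k => // k IH; rewrite mulrS -IH.
Qed.

Lemma eval_tmulz e t k : eval e (tmulz k t) = eval e t *~ k.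
Proof.
case: k => k; first exact: eval_nmul.
by rewrite -[LHS]/(- eval e (nmul k.+1 t)) eval_nmul.
Qed.

Lemma eval_morph (B : abelianLGroup) (f : A -> B) e t :
  {morph f : a b / a + b} -> {morph f : a b / lg_join a b} ->
  {morph f : a b / lg_meet a b} -> eval (f \o e) t = f (eval e t).
Proof.
move=> fD fJ fM; have f0 : f 0 = 0 by apply: (addrI (f 0)); rewrite -fD !addr0.
elim: t => //= [t -> | t -> u -> | t -> u -> | t -> u ->] //.
by apply: (addrI (f (eval e t))); rewrite -fD !subrr.
Qed.

End Eval.

Lemma eval_lterm (V : finType) (A : abelianLGroup) (e : V -> A) (l : lform V) :
  eval e (lterm l) = leval e l.
Proof.
rewrite /leval /lterm; elim: (index_enum V) => [|v s IH] /=.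
  by rewrite big_nil.
by rewrite big_cons eval_tmulz IH.
Qed.

Section Scaling.
Variable A : abelianLGroup.
Implicit Types a b c : A.

(** Torsion-freeness is a Horn clause valid over the integers. *)
Lemma lmulrn_eq0 a k : (0 < k)%N -> a *+ k = 0 -> a = 0.
Proof.
move=> k0 ak; apply: (@horn_transfer _ (nmul k (Var tt)) (Var tt) _ A (fun=> a));
  last by rewrite eval_nmul.
move=> e; rewrite eval_nmul /= => /eqP.
by rewrite mulrn_eq0 -leqn0 leqNgt k0 /= => /eqP.
Qed.

Lemma lmulrnI k a b : (0 < k)%N -> a *+ k = b *+ k -> a = b.
Proof.
move=> k0 ab; apply/eqP; rewrite -subr_eq0; apply/eqP.
by apply: (lmulrn_eq0 k0); rewrite mulrnBl ab subrr.
Qed.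

Lemma identity_transfer (V : finType) (s t : term V) :
  (forall e : V -> int_lgroup, eval e s = eval e t) ->
  forall e : V -> A, eval e s = eval e t.
Proof.
move=> st e; apply/eqP; rewrite -subr_eq0; apply/eqP.
apply: (@horn_transfer _ Zero (Add s (Opp t))) => // e' _.
by rewrite /= st subrr.
Qed.

Lemma lmulrn_join k : {morph (fun a => a *+ k) : a b / lg_join a b}.
Proof.
move=> a b; pose e i := if i then a else b.
pose s := Join (Var true) (Var false).
have : eval e (nmul k s) = eval e (subst_term (fun i => nmul k (Var i)) s); last first.
  by rewrite eval_subst_term /= !eval_nmul.
apply: identity_transfer => f; rewrite eval_subst_term eval_nmul /= !eval_nmul /=.
case: (leP (f true) (f false)) => [|/ltW] h; symmetry.
  by apply/max_idPr; exact: ler_wMn2r.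
by apply/max_idPl; exact: ler_wMn2r.
Qed.

Lemma lmulrn_meet k : {morph (fun a => a *+ k) : a b / lg_meet a b}.
Proof.
move=> a b; pose e i := if i then a else b.
pose s := Meet (Var true) (Var false).
have : eval e (nmul k s) = eval e (subst_term (fun i => nmul k (Var i)) s); last first.
  by rewrite eval_subst_term /= !eval_nmul.
apply: identity_transfer => f; rewrite eval_subst_term eval_nmul /= !eval_nmul /=.
case: (leP (f true) (f false)) => [|/ltW] h; symmetry.
  by apply/min_idPl; exact: ler_wMn2r.
by apply/min_idPr; exact: ler_wMn2r.
Qed.

Lemma eval_mulrn (V : Type) (e : V -> A) t k :
  eval (fun v => e v *+ k) t = eval e t *+ k.
Proof.
apply: (eval_morph (f := fun a => a *+ k)) => [a b||].
- exact: mulrnDl.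
- exact: lmulrn_join.
- exact: lmulrn_meet.
Qed.

Lemma lle_mulrz a (i j : int) : lle 0 a -> i <= j -> lle (a *~ i) (a *~ j).
Proof.
move=> a0 ij; rewrite -(subrK i j) mulrzDr addrC; apply: lleDr.
have [k ->] : exists k : nat, j - i = k by exists (absz (j - i)); lia.
by rewrite -pmulrn; exact: lle0Mn.
Qed.

(** For nonnegative [a], the map sending [k] to [a *~ k] is monotone on the chain of integers, hence
    an l-group morphism. *)
Lemma eval_mulrz (V : Type) (e : V -> int) a t : lle 0 a ->
  eval (fun v => a *~ e v) t = a *~ eval (e : V -> int_lgroup) t.
Proof.
move=> a0; apply: (eval_morph (A := int_lgroup) (f := fun k : int => a *~ k)) => i j.
- exact: mulrzDr.
- have [|/ltW] := leP i j => ij; have h := lle_mulrz a0 ij.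
    by have -> : lg_join (i : int_lgroup) j = j; [exact/max_idPr | rewrite h].
  have -> : lg_join (i : int_lgroup) j = i by exact/max_idPl.
  by rewrite lg_joinC h.
have [|/ltW] := leP i j => ij; have h := lle_mulrz a0 ij.
  have -> : lg_meet (i : int_lgroup) j = i by exact/min_idPl.
  by rewrite (lle_meet_id h).
have -> : lg_meet (i : int_lgroup) j = j by exact/min_idPr.
by rewrite lg_meetC (lle_meet_id h).
Qed.

Lemma lpos_neg a : a = lg_join a 0 - lg_join (- a) 0.
Proof.
apply/eqP; rewrite eq_sym subr_eq; apply/eqP.
by rewrite lg_addr_joinr subrr addr0 lg_joinC.
Qed.

End Scaling.

(** * Piecewise linear functions as max-min terms *)

Section PiecewiseLinear.
Variable V : finType.

Lemma join_term (I : eqType) (s : seq I) (f : I -> term V) : s != [::] ->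
  exists t, forall e : V -> int_lgroup,
    (forall i, i \in s -> eval e (f i) <= eval e t :> int) /\
    (exists2 i, i \in s & eval e t = eval e (f i)).
Proof.
elim: s => // i [|j s] IH _.
  exists (f i) => e; split=> [k|]; first by rewrite inE => /eqP ->.
  by exists i; rewrite ?mem_head.
have [//|t tP] := IH; exists (Join (f i) t) => e.
have [t1 [k ks tE]] := tP e; split=> [l|].
  rewrite inE => /orP[/eqP ->|/t1 ls]; apply/lle_int; first exact: lle_joinl.
  by apply: lle_trans (lle_joinr _ _); apply/lle_int.
have [h|/ltW h] := leP (eval e (f i) : int) (eval e t).
  by exists k; [rewrite in_cons ks orbT | rewrite -tE; exact/max_idPr].
by exists i; [exact: mem_head | exact/max_idPl].
Qed.

Lemma meet_term (I : eqType) (s : seq I) (f : I -> term V) : s != [::] ->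
  exists t, forall e : V -> int_lgroup,
    (forall i, i \in s -> eval e t <= eval e (f i) :> int) /\
    (exists2 i, i \in s & eval e t = eval e (f i)).
Proof.
move=> s0; have [t tP] := join_term (fun i => Opp (f i)) s0.
exists (Opp t) => e; have [t1 [i si tE]] := tP e; split=> [j /t1 /=|].
  by rewrite lerNl.
by exists i => //=; rewrite tE /= opprK.
Qed.

(* The witness is the maximum, over the sets [S q] of the indices [i] with
   [g q <= f i q], of the minimum of [f] over [S q]. *)
Lemma max_min_term (I : finType) (f : I -> term V) (g : (V -> int) -> int) :
  (forall p q, exists i, g p <= eval (p : V -> int_lgroup) (f i) :> int /\
                         eval (q : V -> int_lgroup) (f i) <= g q :> int) ->
  exists t, forall p, eval (p : V -> int_lgroup) t = g p.
Proof.
move=> H; pose S p := [set i | g p <= eval (p : V -> int_lgroup) (f i) :> int].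
have S0 p : enum (S p) != [::].
  have [i [ip _]] := H p p; have : i \in enum (S p) by rewrite mem_enum inE.
  by case: (enum _).
have /choice [m mP] : forall X : {set I}, exists t, (exists p, X = S p) ->
    forall e : V -> int_lgroup,
    (forall i, i \in X -> eval e t <= eval e (f i) :> int) /\
    (exists2 i, i \in X & eval e t = eval e (f i)).
  (* Sets not of the form [S p] get the arbitrary value [Zero]. *)
  move=> X; have [[p ->]|nX] := pselect (exists p, X = S p); last by exists Zero.
  have [t tP] := meet_term f (S0 p); exists t => _ e.
  have [t1 [i iS iE]] := tP e.
  by split=> [j jS|]; [apply: t1; rewrite mem_enum|exists i => //; rewrite -mem_enum].
pose Ss := [seq X <- enum {set I} | `[< exists p, X = S p >]].
have SsP X : X \in Ss <-> exists p, X = S p.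
  by rewrite mem_filter mem_enum andbT; split => [/asboolP|/asboolP].
have [|t tP] := @join_term _ Ss m.
  have /SsP : exists p, S (fun=> 0) = S p by exists (fun=> 0).
  by apply: contraTneq => ->.
exists t => p; have [t1 [X XS tE]] := tP p.
apply/le_anti/andP; split.
  (* The index given by [H q p] belongs to [S q], and its form at [p] is at most [g p]. *)
  have [q Xq] := (SsP X).1 XS; have [i [iq ip]] := H q p.
  have [m1 _] := mP X (ex_intro _ q Xq) p.
  by rewrite tE; apply: le_trans (m1 i _) ip; rewrite Xq inE.
have Sp : exists q, S p = S q by exists p.
have [_ [i iS iE]] := mP _ Sp p.
by apply: le_trans (t1 _ ((SsP _).2 Sp)); rewrite iE; rewrite inE in iS.
Qed.

(** The hypothesis of [max_min_term] for points [p] and [q] comes from [crossing_piece] on the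
    segment joining them. *)
Lemma piecewise_linear_term (ps : seq (seq (lform V) * lform V))
    (g : (V -> int) -> int) :
  (forall x, exists2 p, p \in ps & forall c, c \in p.1 -> 0 <= dot x c) ->
  (forall x p, p \in ps -> (forall c, c \in p.1 -> 0 <= dot x c) ->
     dot x p.2 = g x) ->
  exists t, forall x, eval (x : V -> int_lgroup) t = g x.
Proof.
move=> cover agree.
apply: (max_min_term (f := fun i => lterm (tnth (in_tuple ps) i).2)) => p q.
suff [l lps [lp lq]] : exists2 l, l \in ps & g p <= dot p l.2 /\ dot q l.2 <= g q.
  have /tnthP[i iE] : l \in in_tuple ps by [].
  by exists i; rewrite !eval_lterm !leval_int -iE.
pose line (a b : int) : rat * rat := (a%:~R, (b - a)%:~R).
(* Subtracting the affine interpolation between [g p] and [g q] makes the crossing occur at height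
   [0]. *)
pose restrict (l : seq (lform V) * lform V) :=
  ([seq line (dot p c) (dot q c) | c <- l.1],
   line (dot p l.2 - g p) (dot q l.2 - g q)).
have line0 a b : aff (line a b) 0 = a%:~R by rewrite /aff mulr0 addr0.
have line1 a b : aff (line a b) 1 = b%:~R by rewrite /aff mulr1 /= intrB addrC subrK.
(* The rational point of parameter [s] on the segment, multiplied by the denominator of [s] to be
   integral. *)
pose w (s : rat) v := p v * (denq s - numq s) + q v * numq s.
have lineE s a b :
    aff (line a b) s * (denq s)%:~R = (a * (denq s - numq s) + b * numq s)%:~R.
  rewrite /aff /= -{1}(divq_num_den s) mulrDl -mulrA divfK ?intr_eq0 ?denq_neq0 //.
  by rewrite !(rmorphD, rmorphN, rmorphM) /=; ring.
have den0 (s : rat) : 0 < (denq s)%:~R :> rat by rewrite ltr0z denq_gt0.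
have activeP l s : active (restrict l) s -> forall c, c \in l.1 -> 0 <= dot (w s) c.
  move=> /allP act c cl; have /act : line (dot p c) (dot q c) \in (restrict l).1.
    exact: (map_f (fun c => line (dot p c) (dot q c))).
  by rewrite -(pmulr_lge0 _ (den0 s)) lineE ler0z dot_lincomb.
have [|s /andP[s0 s1]|_ _ s /mapP[l lps ->] /mapP[l' l'ps ->] act act'|
      _ /mapP[l lps ->]|_ /mapP[l lps ->]|_ /mapP[l lps ->]] :=
    @crossing_piece rat (map restrict ps) 0 1.
- exact: ler01.
- have [l lps act] := cover (w s); apply/hasP; exists (restrict l); first exact: map_f.
  apply/allP => _ /mapP[c cl ->] /=.
  by rewrite -(pmulr_lge0 _ (den0 s)) lineE ler0z -dot_lincomb; exact: act.
- apply: (mulIf (lt0r_neq0 (den0 s))); rewrite !lineE; congr _%:~R.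
  have E := agree _ _ lps (activeP _ _ act).
  have E' := agree _ _ l'ps (activeP _ _ act').
  move: E; rewrite -E' /w !dot_lincomb => E.
  have split_g (a b c d m n : int) :
      (a - c) * m + (b - d) * n = (a * m + b * n) - (c * m + d * n) by ring.
  by rewrite !split_g E.
- rewrite line0 => act; rewrite agree ?subrr // => c cl.
  have := allP act _ (map_f _ cl); rewrite line0 ler0z; exact.
- rewrite line1 => act; rewrite agree ?subrr // => c cl.
  have := allP act _ (map_f _ cl); rewrite line1 ler0z; exact.
- by rewrite line0 line1 ler0z lerz0 subr_ge0 subr_le0; exists l.
Qed.

End PiecewiseLinear.
End Terms.

(** * Existence and uniqueness of solutions of an equation [u = 0], and divisibility *)

Definition pair_assign (T : Type) (n m : nat) (x : 'I_n -> T) (z : 'I_m -> T)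
    (v : 'I_n + 'I_m) : T :=
  match v with inl i => x i | inr j => z j end.

Definition divisible (k : nat) (A : abelianLGroup) :=
  forall a : A, exists b : A, (b *+ k)%R = a.

Section System.
Local Open Scope ring_scope.
Variables (n m : nat) (u : term ('I_n + 'I_m)).

Definition sol (A : abelianLGroup) (x : 'I_n -> A) (z : 'I_m -> A) :=
  eval (pair_assign x z) u = 0.

Definition total (A : abelianLGroup) :=
  forall x : 'I_n -> A, exists z, sol x z.

Definition functional (A : abelianLGroup) :=
  forall (x : 'I_n -> A) z z', sol x z -> sol x z' -> z =1 z'.

Definition isol (x : 'I_n -> int) (z : 'I_m -> int) := @sol int_lgroup x z.

Lemma sol_ext (A : abelianLGroup) (x x' : 'I_n -> A) z z' :
  x =1 x' -> z =1 z' -> sol x z -> sol x' z'.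
Proof. by move=> /funext -> /funext ->. Qed.

Lemma sol_mulrn (A : abelianLGroup) (x : 'I_n -> A) z k :
  sol x z -> sol (fun i => x i *+ k) (fun j => z j *+ k).
Proof.
move=> xz; rewrite /sol -[RHS](mul0rn _ k) -xz -eval_mulrn.
by apply: eval_ext => -[].
Qed.

Lemma sol_mulrnI (A : abelianLGroup) (x : 'I_n -> A) z k : (0 < k)%N ->
  sol (fun i => x i *+ k) (fun j => z j *+ k) -> sol x z.
Proof.
move=> k0 xz; apply: (lmulrn_eq0 k0); rewrite -eval_mulrn -xz.
by apply: eval_ext => -[].
Qed.

Lemma sol_mulrz (A : abelianLGroup) (a : A) x z : lle 0 a -> isol x z ->
  sol (fun i => a *~ x i) (fun j => a *~ z j).
Proof.
move=> a0 xz; rewrite /sol -[RHS](mulr0z a) -[X in _ *~ X]xz -eval_mulrz //.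
by apply: eval_ext => -[].
Qed.

Lemma lmulrz_inj (A : abelianLGroup) (a : A) (i j : int) :
  a <> 0 -> a *~ i = a *~ j -> i = j.
Proof.
move=> a0 ij; apply/eqP; rewrite -subr_eq0; apply/eqP; apply: contrapT => d0.
have ad : a *~ (i - j) = 0 by rewrite mulrzBr ij subrr.
case: (i - j) d0 ad => k d0 ad; apply: a0.
  by apply: (@lmulrn_eq0 _ _ k) => //; rewrite lt0n; apply: contra_notN d0 => /eqP ->.
by apply: (@lmulrn_eq0 _ _ k.+1) => //; apply/eqP; rewrite -oppr_eq0 -ad.
Qed.

Lemma exists_pos (A : abelianLGroup) : nontrivial A -> exists a : A, lle 0 a /\ a <> 0.
Proof.
move=> [a [b ab]]; exists (labs (a - b)); split; first exact: labs_ge0.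
move=> d0; apply: ab; apply/eqP; rewrite -subr_eq0; apply/eqP.
by apply: labs_le0; rewrite d0; exact: lle_refl.
Qed.

Lemma labsD_eq0 (A : abelianLGroup) (a b : A) :
  labs a + b = 0 -> lle 0 b -> a = 0 /\ b = 0.
Proof.
move=> ab b0; have a0 : a = 0 by apply: labs_le0; rewrite -ab; exact: lleDr.
split=> //; move: ab; rewrite a0 => <-.
by rewrite /labs oppr0 (lle_refl 0) add0r.
Qed.

(** Uniqueness is a Horn clause about two copies of [z], its two premises being merged by a sum of
    absolute values. It holds over the integers because the multiples of a positive element of [A]
    form a copy of them. *)
Lemma functional_transfer (A B : abelianLGroup) :
  nontrivial A -> functional A -> functional B.
Proof.
move=> /exists_pos[a [a0 aN0]] fA x z z' xz xz' j.
pose W := ('I_n + ('I_m + 'I_m))%type.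
pose copy (f : 'I_m -> 'I_m + 'I_m) :=
  subst_term (pair_assign (fun i => Var (inl i : W)) (fun j => Var (inr (f j) : W))) u.
have copyE (C : abelianLGroup) (e : W -> C) f :
    eval e (copy f) = 0 <-> sol (e \o inl) (e \o inr \o f).
  rewrite eval_subst_term /sol.
  rewrite (@eval_ext _ _ _ (pair_assign (e \o inl) (e \o inr \o f))) //.
  by case.
pose e (w : W) := match w with
  | inl i => x i | inr (inl j) => z j | inr (inr j) => z' j end.
apply/eqP; rewrite -subr_eq0; apply/eqP.
apply: (@horn_transfer _ (Add (tabs (copy inl)) (tabs (copy inr)))
          (Add (Var (inr (inl j))) (Opp (Var (inr (inr j))))) _ B e); last first.
  have -> : eval e (Add (tabs (copy inl)) (tabs (copy inr)))
            = labs (eval e (copy inl)) + labs (eval e (copy inr)) by [].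
  rewrite (copyE _ _ _).2 // (copyE _ _ _).2 // /labs oppr0 (lle_refl 0).
  exact: addr0.
move=> f.
have -> : eval f (Add (tabs (copy inl)) (tabs (copy inr)))
          = labs (eval f (copy inl)) + labs (eval f (copy inr)) by [].
move=> /labsD_eq0 [|/copyE fl]; first exact: labs_ge0.
rewrite -[labs _]addr0 => /labsD_eq0 [|/copyE fr _]; first exact: lle_refl.
have /(lmulrz_inj aN0) E := fA _ _ _ (sol_mulrz a0 fl) (sol_mulrz a0 fr) j.
by move: E => /= ->; rewrite subrr.
Qed.

(* The Horn clause "if (x C, z) is a solution and C is nonnegative then C = 0"
   fails in [A], hence over the integers. *)
Lemma total_rational (A : abelianLGroup) : nontrivial A -> total A ->
  forall x : 'I_n -> int, exists2 c : nat, (0 < c)%N &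
    exists z, isol (fun i => x i *+ c) z.
Proof.
move=> /exists_pos[a [a0 aN0]] tA x; apply: contrapT => nox.
pose W := option 'I_m.
pose ux := subst_term (pair_assign (fun i => tmulz (x i) (Var (None : W)))
                               (fun j => Var (Some j : W))) u.
have uxE (C : abelianLGroup) (e : W -> C) :
    eval e ux = 0 <-> sol (fun i => e None *~ x i) (e \o Some).
  rewrite eval_subst_term /sol (@eval_ext _ _ _
    (pair_assign (fun i => e None *~ x i) (e \o Some))) //.
  by case=> // i; rewrite /= eval_tmulz.
(* The variable [None] stands for [C]; the second summand vanishes exactly when [C] is
   nonnegative. *)
pose t := Add (tabs ux) (tabs (Meet (Var (None : W)) Zero)).
have [z xz] := tA (fun i => a *~ x i).
pose e w := if w is Some j then z j else a.
apply: aN0; apply: (@horn_transfer _ t (Var (None : W)) _ _ e); last first.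
  have -> : eval e t = labs (eval e ux) + labs (lg_meet a 0) by [].
  rewrite (uxE _ _).2 // lg_meetC (lle_meet_id a0) /labs oppr0 (lle_refl 0).
  exact: addr0.
move=> f; have -> : eval f t = labs (eval f ux) + labs (lg_meet (f None) 0) by [].
move=> /labsD_eq0 [|/uxE fx]; first exact: labs_ge0.
rewrite -[labs _]addr0 => /labsD_eq0 [|/= f0 _]; first exact: lle_refl.
have {}f0 : 0 <= (f None : int) by move: f0 => /min_idPr.
apply: contrapT => fN0; apply: nox; exists (absz (f None : int)).
  by rewrite absz_gt0; exact/eqP.
exists (f \o Some); apply: sol_ext fx => // i.
by rewrite pmulrn gez0_abs // !mulrzz mulrC.
Qed.

(** The divisor is the reduced denominator [b] of [z j / k]. For nonnegative [a], solving the system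
    at [a *~ x i] and using uniqueness gives [y j *+ b = a *~ c] with [c] prime to [b], so [a] is
    divisible by [b]. Any element is a difference of two nonnegative ones. *)
Lemma solution_divides (A : abelianLGroup) k (x : 'I_n -> int) z j :
  total A -> functional A -> (0 < k)%N -> isol (fun i => x i *+ k) z ->
  divisible (k %/ gcdn k (absz (z j))) A.
Proof.
move=> tA fA k0 xz.
set g := gcdn _ _; set b := (k %/ g)%N.
have g0 : (0 < g)%N by rewrite gcdn_gt0 k0.
have kE : k = (b * g)%N by rewrite divnK // dvdn_gcdl.
pose c := (z j %/ g)%Z.
have zE : z j = c * g by rewrite divzK // dvdzE dvdn_gcdr.
have [p [q pq]] : exists p q : int, p * c + q * b = 1.
  have [p [q pq]] := Bezoutz (z j) k; exists p, q.
  have gN0 : g%:Z != 0 by rewrite -lt0n in g0 *; lia.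
  apply: (mulIf gN0); rewrite mulrDl mul1r -!mulrA -zE -PoszM -kE pq.
  by rewrite /gcdz gcdnC.
have pos a : lle 0 a -> exists y : A, y *+ b = a.
  move=> a0; have [y xy] := tA (fun i => a *~ x i).
  have E : y j *+ k = a *~ z j.
    apply: (fA _ _ (fun j => a *~ z j) (sol_mulrn k xy)).
    apply: sol_ext (sol_mulrz a0 xz) => // i.
    by rewrite /= [RHS]pmulrn -mulrzA -mulrzz -pmulrn.
  have {}E : y j *+ b = a *~ c.
    apply: (lmulrnI g0); rewrite -mulrnA -kE E zE pmulrn.
    by rewrite mulrzA.
  (* Multiplied by [b], this is [a *~ (p * c + q * b)], and the Bezout relation makes the factor
     [1]. *)
  exists (y j *~ p + a *~ q).
  by rewrite mulrnDl !pmulrn mulrzAC -pmulrn E -!mulrzA -mulrzDr mulrC pq mulr1z.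
move=> a; have [y yE] := pos _ (lle_joinr a 0).
have [y' yE'] := pos _ (lle_joinr (- a) 0).
by exists (y - y'); rewrite mulrnBl yE yE' -lpos_neg.
Qed.

Definition int_constraints := [seq - p.1 :: p.1 :: p.2 | p <- pieces u].

(** For the direct implication, [select_piece] is run over the integers with [h = 1]: keeping [1]
    from lying below [0] modulo [s] forces [s = 0], so that the order modulo [s] is the usual
    one. *)
Lemma isolP x z : isol x z <->
  exists2 cs, cs \in int_constraints &
    forall c, c \in cs -> 0 <= dot (pair_assign x z) c.
Proof.
set e : _ -> int_lgroup := pair_assign x z; split.
  move=> xz; have n10 : ~ lle_mod (0 : int_lgroup) 1 0.
    by case=> k; rewrite mul0rn addr0 => /lle_int.
  have [s [p [/lle_int s0 ns [pu up pu0 H]]]] := select_piece e u (lle_refl 0) n10.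
  have {s0 ns} sE : s = 0.
    apply/eqP; rewrite eq_le s0 andbT leNgt; apply/negP => s1; apply: ns.
    exists 1%N; apply/lle_int; rewrite add0r mulr1n; lia.
  have modE (a b : int_lgroup) : lle_mod s a b -> a <= b :> int.
    by rewrite sE => -[k]; rewrite mul0rn addr0 => /lle_int.
  move: up pu0 => /modE + /modE; rewrite [eval e u]xz leval_int => up pu0.
  exists (- p.1 :: p.1 :: p.2); first exact: (map_f (fun p => - p.1 :: p.1 :: p.2)).
  move=> c; rewrite !inE => /or3P[/eqP ->|/eqP ->|/H/modE]; rewrite ?leval_int //.
  by rewrite raddfN oppr_ge0.
case=> _ /mapP[p pu ->] H; rewrite /isol /sol (eval_piece pu) => [|c cp].
  rewrite leval_int; have := H _ (mem_head _ _); rewrite raddfN oppr_ge0 => p0.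
  by apply/le_anti/andP; split => //; apply: H; rewrite !inE eqxx orbT.
by apply/lle_int; rewrite leval_int; apply: H; rewrite !inE cp !orbT.
Qed.

Definition row_assign k (x : 'rV[int]_n) (z : 'rV[int]_m) :=
  pair_assign (fun i => x 0 i *+ k) (z 0).

Definition cone (cs : seq (lform ('I_n + 'I_m)%type)) k x z :=
  forall c, c \in cs -> 0 <= dot (row_assign k x z) c.

Lemma dot_row_assignD k x z x' z' c :
  dot (row_assign k (x + x') (z + z')) c
  = dot (row_assign k x z) c + dot (row_assign k x' z') c.
Proof.
rewrite /dot -big_split; apply: eq_bigr => v _ /=; rewrite -mulrDl; congr (_ * _).
by case: v => i; rewrite /= mxE ?mulrnDl.
Qed.

Lemma dot_row_assignMn k x z N c :
  dot (row_assign k (x *+ N) (z *+ N)) c = dot (row_assign k x z) c *+ N.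
Proof.
elim: N => [|N IH]; last by rewrite !mulrS dot_row_assignD IH.
rewrite !mulr0n /dot big1 // => v _.
by case: v => i; rewrite /= mxE ?mul0rn mul0r.
Qed.

Lemma cone_isol cs k x z : cs \in int_constraints -> cone cs k x z ->
  isol (fun i => x 0 i *+ k) (z 0).
Proof. by move=> cscs xz; apply/isolP; exists cs. Qed.

Lemma coneMn cs k x z N : cone cs k x z -> cone cs k (x *+ N) (z *+ N).
Proof. by move=> xz c /xz; rewrite dot_row_assignMn => ?; exact: mulrn_wge0. Qed.

Lemma coneMnI cs k x z N : (0 < N)%N ->
  cone cs k (x *+ N) (z *+ N) -> cone cs k x z.
Proof. by move=> N0 xz c /xz; rewrite dot_row_assignMn pmulrn_lge0. Qed.

Hypothesis Zfun : functional int_lgroup.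

(** By uniqueness, the pairs in one cone form the graph of a partial additive map, to which
    [linear_extension] applies. *)
Lemma cone_linear (T : nat -> Prop) k cs :
  T 1%N -> (forall a b, T a -> T b -> T (a * b)%N) ->
  cs \in int_constraints ->
  (forall N x z, (0 < N)%N -> cone cs k (x *+ N) z ->
     exists2 l, T l & exists z', cone cs k (x *+ l) z') ->
  exists2 l, T l & exists M, forall x z, cone cs k x z -> z *+ l = x *m M.
Proof.
move=> T1 TM cscs sat; apply: linear_extension => //.
- move=> c _; have := dot_row_assignMn k 0 0 0 c.
  by rewrite !mulr0n => ->.
- move=> x z x' z' xz xz' c ccs; rewrite dot_row_assignD.
  by rewrite addr_ge0 ?xz ?xz'.
- move=> x z z' /(cone_isol cscs) xz /(cone_isol cscs) xz'.
  by apply/rowP => j; exact: (Zfun xz xz').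
Qed.

(** Here [T] consists of all positive integers, so saturation is trivial and each cone has a
    denominator [l cs]; their product serves for all cones. *)
Lemma uniform_denominator :
  (forall x : 'I_n -> int, exists2 c : nat, (0 < c)%N &
     exists z, isol (fun i => x i *+ c) z) ->
  exists2 K : nat, (0 < K)%N & forall x, exists z, isol (fun i => x i *+ K) z.
Proof.
move=> H.
have /choice [l lP] : forall cs, exists l, (0 < l)%N /\ (cs \in int_constraints ->
    exists M, forall x z, cone cs 1 x z -> z *+ l = x *m M).
  move=> cs; have [cscs|ncs] := boolP (cs \in int_constraints); last by exists 1%N.
  have [//|a b|//|N x z N0 xz|l l0 M] := @cone_linear (fun l => 0 < l)%N 1 cs.
  - by rewrite muln_gt0 => -> ->.
  - by exists N => //; exists z.
  - by exists l.
exists (\prod_(cs <- int_constraints) l cs)%N.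
  by rewrite big_seq prodn_cond_gt0 // => cs _; have [] := lP cs.
move=> x; have [c c0 [z /isolP [cs cscs xz]]] := H x.
have [l0 /(_ cscs) [M MP]] := lP cs.
pose X := \row_i x i; pose Z := \row_j z j.
have XZ : cone cs 1 (X *+ c) Z.
  move=> d /xz; congr (0 <= dot _ d); apply/funext => -[i|j] /=; last by rewrite mxE.
  by rewrite mulr1n mulmxnE mxE.
(* Multiplying [XZ] by [l cs] gives [c] times this pair, and [c] cancels in the inequalities. *)
have XM : cone cs 1 (X *+ l cs) (X *m M).
  apply: (coneMnI c0); have := coneMn (l cs) XZ; rewrite (MP _ _ XZ) mulrnAC.
  by have -> : (X *+ c) *m M = (X *m M) *+ c by rewrite -!scaler_nat scalemxAl.
rewrite (big_rem cs) //=; set r := (\prod_(_ <- _) _)%N.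
exists (fun j => (X *m M) 0 j *+ r).
apply: sol_ext (sol_mulrn r (cone_isol cscs XM)) => // i.
by rewrite mulr1n mulmxnE mxE mulrnA.
Qed.

(** Here [T] is reduced to [1]: a solution exists at [k] times every integer point, so each cone
    carries an integral matrix without any further denominator. *)
Lemma integral_solution_terms k : (0 < k)%N ->
  (forall x, exists z, isol (fun i => x i *+ k) z) ->
  exists t : 'I_m -> term 'I_n, forall x : 'I_n -> int_lgroup,
    isol (fun i => x i *+ k) (fun j => eval x (t j)).
Proof.
move=> k0 /choice [z zP].
have zE x y : isol (fun i => x i *+ k) y -> y =1 z x by move=> xy; exact: Zfun (zP x).
have /choice [M MP] : forall cs, exists M, cs \in int_constraints ->
    forall x y, cone cs k x y -> y = x *m M.
  move=> cs; have [cscs|ncs] := boolP (cs \in int_constraints); last by exists 0.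
  have [//|a b|//|N x y N0 xy|l <- [M MP]] := @cone_linear (eq 1%N) k cs.
  - by move=> <- <-.
  (* By uniqueness, [y] is [N] times the solution at [x], which therefore lies in the same cone. *)
  - exists 1%N => //; exists (\row_j z (x 0) j); rewrite mulr1n; apply: (coneMnI N0).
    suff <- : y = (\row_j z (x 0) j) *+ N by [].
    apply/rowP => j; rewrite mulmxnE mxE.
    apply: (Zfun (cone_isol cscs xy) (z' := fun j => z (x 0) j *+ N)).
    apply: sol_ext (sol_mulrn N (zP (x 0))) => // i.
    by rewrite mulmxnE mulrnAC.
  - by exists M => _ x y /MP <-.
(* The constraint [c] on the pair formed by [k] times [x] and the image of [x] under [M cs], as a
   form in [x] alone. *)
pose pull cs (c : lform ('I_n + 'I_m)%type) : lform 'I_n :=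
  [ffun i => c (inl i) *+ k + \sum_j M cs i j * c (inr j)].
pose value cs j : lform 'I_n := [ffun i => M cs i j].
have valueE cs j (x : 'I_n -> int) : dot x (value cs j) = ((\row_i x i) *m M cs) 0 j.
  by rewrite mxE; apply: eq_bigr => i _; rewrite mxE ffunE.
have pullE cs c (x : 'I_n -> int) : dot x (pull cs c) =
    dot (row_assign k (\row_i x i) ((\row_i x i) *m M cs)) c.
  rewrite /dot big_sumType /=.
  under eq_bigr do rewrite ffunE mulrDr mulr_sumr.
  rewrite big_split exchange_big /=; congr (_ + _); apply: eq_bigr => i _.
    by rewrite mxE mulrnAr mulrnAl.
  rewrite mxE mulr_suml; apply: eq_bigr => i' _.
  by rewrite mxE mulrA.
suff /choice [t tP] :
    forall j, exists t, forall x, eval (x : _ -> int_lgroup) t = z x j.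
  by exists t => x; apply: sol_ext (zP x) => // j; rewrite tP.
move=> j; apply: (@piecewise_linear_term _
  [seq (map (pull cs) cs, value cs j) | cs <- int_constraints]
  (fun x => z x j)) => [x|x p].
  have /isolP [cs cscs xz] := zP x.
  exists (map (pull cs) cs, value cs j).
    exact: (map_f (fun cs => (map (pull cs) cs, value cs j))).
  move=> _ /mapP[c ccs ->]; rewrite pullE.
  have XZ : cone cs k (\row_i x i) (\row_j z x j).
    move=> d /xz; congr (0 <= dot _ d).
    by apply/funext => -[i|l] /=; rewrite mxE.
  by rewrite -(MP cs cscs _ _ XZ); exact: XZ.
case/mapP => cs cscs -> /= H; rewrite valueE; apply: zE.
have XM : cone cs k (\row_i x i) ((\row_i x i) *m M cs).
  by move=> c ccs; rewrite -pullE; apply: H; exact: map_f.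
by apply: sol_ext (cone_isol cscs XM) => // i; rewrite mxE.
Qed.

(** The terms solve the system at [k] times [x], identically over the integers and hence in [A].
    Dividing their values by [k] gives a solution at [x], since [k] cancels from both arguments. *)
Lemma divisible_total (A : abelianLGroup) k : (0 < k)%N -> divisible k A ->
  (forall x, exists z, isol (fun i => x i *+ k) z) -> total A.
Proof.
move=> k0 dA /(integral_solution_terms k0) [t tP] x.
have /choice [z zP] : forall j, exists b : A, b *+ k = eval x (t j).
  by move=> j; exact: dA.
exists z; apply: (sol_mulrnI k0).
pose U := subst_term (pair_assign (fun i => nmul k (Var i)) t) u.
have UE (B : abelianLGroup) (y : 'I_n -> B) :
    eval y U = eval (pair_assign (fun i => y i *+ k) (fun j => eval y (t j))) u.
  by rewrite eval_subst_term; apply: eval_ext => -[i|//]; rewrite /= eval_nmul.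
suff xz : eval x U = eval x Zero.
  by rewrite UE in xz; apply: sol_ext xz => // j; rewrite zP.
by apply: identity_transfer => y; rewrite UE; exact: tP.
Qed.

Theorem divisibility_index :
  (forall x : 'I_n -> int, exists2 c : nat, (0 < c)%N &
     exists z, isol (fun i => x i *+ c) z) ->
  exists2 k : nat, (0 < k)%N &
    (forall A, total A -> functional A -> divisible k A) /\
    (forall A, divisible k A -> total A).
Proof.
move=> /uniform_denominator [K K0 HK].
pose forced b := `[< forall A, total A -> functional A -> divisible b A >].
pose k := (\prod_(1 <= b < K.+1 | forced b) b)%N.
have k0 : (0 < k)%N.
  by rewrite /k big_nat_cond prodn_cond_gt0 // => b /andP[/andP[]].
exists k => //; split=> [A tA fA|A dA].
  rewrite /k; elim/big_rec: _ => [a|b l /asboolP bA IH a]; first by exists a.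
  have [a' <-] := bA A tA fA a; have [a'' <-] := IH a'.
  by exists a''; rewrite mulnC mulrnA.
apply: divisible_total k0 dA _ => x; have [z xz] := HK x.
(* The reduced denominator [b] of [z j / K] is forced by [solution_divides] and at most [K], so it
   is a factor of [k]; thus [k * z j / K] is an integer. *)
have /choice [w wP] : forall j, exists w : int, z j *+ k = w *+ K.
  move=> j; pose g := gcdn K (absz (z j)); pose b := (K %/ g)%N.
  have g0 : (0 < g)%N by rewrite gcdn_gt0 K0.
  have KE : K = (b * g)%N by rewrite divnK // dvdn_gcdl.
  have zE : z j = (z j %/ g)%Z * g by rewrite divzK // dvdzE dvdn_gcdr.
  have b0 : (0 < b)%N by rewrite divn_gt0 // dvdn_leq // dvdn_gcdl.
  have fb : forced b by apply/asboolP => B tB fB; exact: solution_divides tB fB K0 xz.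
  have bK : b \in index_iota 1 K.+1 by rewrite mem_index_iota b0 ltnS leq_div.
  have kE : k = (k %/ b * b)%N by rewrite divnK // /k (big_rem b) //= fb dvdn_mulr.
  exists ((z j %/ g)%Z *+ (k %/ b)).
  rewrite -mulrnA [in RHS]KE mulnA -kE mulnC mulrnA; congr (_ *+ k).
  by rewrite {1}zE -mulrzz -pmulrn.
(* Multiplied by [K], the claim becomes [k] times the known solution [xz]. *)
exists w; apply: (sol_mulrnI K0); apply: sol_ext (sol_mulrn k xz) => [i|j].
  by rewrite mulrnAC.
by rewrite wP.
Qed.

End System.

(** * From sentences to systems, and the conclusion *)

Section Models.
Local Open Scope ring_scope.

(** A sum of absolute values vanishes only if every summand does, so one equation encodes the
    conjunction. *)
Definition system_term (phi : efd_sentence) :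
    term ('I_(efd_n phi) + 'I_(efd_m phi)) :=
  foldr (fun i => Add (tabs (Add (efd_lhs i) (Opp (efd_rhs i))))) Zero
    (enum 'I_(efd_k phi)).

Lemma eval_system_term (phi : efd_sentence) (A : abelianLGroup) e :
  eval e (system_term phi) = 0 :> A <->
  forall i : 'I_(efd_k phi), eval e (efd_lhs i) = eval e (efd_rhs i).
Proof.
rewrite /system_term; set f := fun i : 'I_(efd_k phi) => Add _.
have ge0 s : lle (0 : A) (eval e (foldr f Zero s)).
  by elim: s => [|i s IH]; [exact: lle_refl | apply: lle0D IH; exact: labs_ge0].
suff H s : eval e (foldr f Zero s) = 0 <->
    forall i : 'I_(efd_k phi), i \in s -> eval e (efd_lhs i) = eval e (efd_rhs i).
  by rewrite H; split=> E i; [apply: E; rewrite mem_enum | move=> _; exact: E].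
elim: s => [|i s IH]; first by [].
split=> [/labsD_eq0 [//|/eqP + /IH E] j|E].
  by rewrite /= subr_eq0 inE => /eqP iE /orP[/eqP ->|/E].
have -> : forall a b : term ('I_(efd_n phi) + 'I_(efd_m phi)),
  eval e (Add (tabs a) b) = labs (eval e a) + eval e b by [].
rewrite IH.2 /= => [|j js]; last by apply: E; rewrite inE js orbT.
by rewrite E ?mem_head // subrr /labs oppr0 (lle_refl 0) addr0.
Qed.

Lemma models_system (phi : efd_sentence) (A : abelianLGroup) :
  models A phi <-> total (system_term phi) A /\ functional (system_term phi) A.
Proof.
split=> [M|[tA fA] x].
  split=> [x|x z z' xz xz' j].
    have [z [xz _]] := M (finfun x); exists z.
    apply/eval_system_term => i; rewrite -(eval_ext (e := assign (finfun x) z)).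
      by rewrite xz; apply: eval_ext => -[k|k] //=; rewrite ffunE.
    by case=> [k|k] //=; rewrite ffunE.
  have [z0 [_ uniq]] := M (finfun x).
  have E y : sol (system_term phi) x y -> z0 = finfun y.
    move=> xy; apply: uniq; apply/eval_system_term; rewrite -[RHS]xy.
    by apply: eval_ext => -[k|k] /=; rewrite ffunE.
  by have := E _ xz; rewrite (E _ xz') => /ffunP/(_ j); rewrite !ffunE.
have [z xz] := tA x; exists (finfun z); split.
  apply/eval_system_term; rewrite -[RHS]xz.
  by apply: eval_ext => -[k|k] //=; rewrite ffunE.
move=> z' /eval_system_term xz'; apply/ffunP => j; rewrite ffunE.
apply: (fA x z z' xz); rewrite /sol -[RHS]xz'.
by apply: eval_ext => -[k|k].
Qed.

(** Uniqueness of the quotient by [k] is torsion-freeness. *)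
Lemma models_delta k (A : abelianLGroup) : (0 < k)%N ->
  models A (delta k) <-> divisible k A.
Proof.
move=> k0; split=> [M a|dA x].
  have [z [/(_ ord0) zE _]] := M [ffun=> a]; exists (z ord0).
  by move: zE; rewrite eval_nmul /= ffunE.
have [b bE] := dA (x ord0); exists [ffun=> b]; split=> [i|z /(_ ord0) zE].
  by rewrite eval_nmul /= ffunE.
apply/ffunP => j; rewrite ffunE [j]ord1; apply: (lmulrnI k0).
by move: zE; rewrite eval_nmul /= bE => ->.
Qed.

End Models.

Theorem theorem4p12 (phi : efd_sentence)
    (hphi : exists A : abelianLGroup, nontrivial A /\ models A phi) :
  exists k : nat, 0 < k /\ sim phi (delta k).
Proof.
have [A [nA /models_system [tA fA]]] := hphi.
(* Uniqueness holds in every l-group, so being a model of [phi] amounts to solvability of its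
   system. *)
have fB B := @functional_transfer _ _ _ _ B nA fA.
have [k k0 [div tot]] := divisibility_index (fB int_lgroup) (total_rational nA tA).
exists k; split=> // B; rewrite (models_delta B k0) models_system.
by split=> [[tB _]|dB]; [exact: div | split; [exact: tot | exact: fB]].
Qed.
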